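(* Let $(M,\mathcal{F})$ be a foliated manifold and let $A$ be a Lie algebroid over $M$. If the Lie subalgebroid $B\subseteq A$ is a foliation of $A$ over $(M,\mathcal{F})$, then the tangent Lie algebroid $TB\to TM$ is a foliation of the tangent Lie algebroid $TA\to TM$ over the foliated manifold $(TM,T\mathcal{F})$.
   Context: All objects are $C^\infty$. A foliation $\mathcal{F}$ on $M$ has local adapted coordinates $(x^a,y^u)$ in which the leaves are $x^a=\mathrm{const}$; $T\mathcal{F}$ (also written $F$) is the subbundle of $TM$ tangent to the leaves. Lie subalgebroids are vector subbundles over the same base $M$ whose sections are closed under the bracket. Foliations of Lie algebroids. Let $A$ be a Lie algebroid over $(M,\mathcal{F})$ with anchor $\sharp_A$ and bracket $[\,,\,]_A$, and let $B\subseteq A$ be a Lie subalgebroid. A (local) section $a$ of $A$ is $B$-foliated if $[b,a]_A\in\Gamma B$ for all $b\in\Gamma B$. $B$ is a foliation of $A$ over $\mathcal{F}$ if (1) $\sharp_A(B)=T\mathcal{F}$, and (2) locally $\Gamma A$ is spanned over $C^\infty$ functions by $B$-foliated sections of $A$. The foliation $T\mathcal{F}$ of the manifold $TM$: in the coordinates $(x^a,y^u,\dot x^a,\dot y^u)$ of $TM$ induced by adapted coordinates of $M$ its leaves are given by $x^a=\mathrm{const}$, $\dot x^a=\mathrm{const}$. Tangent Lie algebroid. For a vector bundle $\pi:A\to M$, $\pi_*:TA\to TM$ is a vector bundle. If $(x^i)$ are coordinates on $M$, $(a_\alpha)$ is a local basis of $\Gamma A$ with fiber coordinates $(\xi^\alpha)$,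 and $(x^i,\xi^\alpha,\dot x^i,\dot\xi^\alpha)$ are the induced coordinates of $TA$, then $(\xi^\alpha,\dot\xi^\alpha)$ are fiber coordinates of $\pi_*$. A section $a$ of $A$ has a complete lift $a^C=a_*:TM\to TA$ (the differential of $a:M\to A$), and a vertical lift $a^V$, which for $a=\eta^\alpha a_\alpha$ is the section $\eta^\alpha\,\partial/\partial\xi^\alpha$ of $\pi_*$; the sections $(a_\alpha^C,a_\alpha^V)$ form a local basis of sections of $TA\to TM$. If $A$ is a Lie algebroid, the tangent Lie algebroid is $\pi_*:TA\to TM$ with anchor $\sharp_{TA}(a^C)=(\sharp_Aa)^C$, $\sharp_{TA}(a^V)=(\sharp_Aa)^V$ (on the right, the complete and vertical lifts of vector fields from $M$ to $TM$) and bracket determined by $[a_1^V,a_2^V]_{TA}=0$, $[a_1^C,a_2^V]_{TA}=([a_1,a_2]_A)^V$, $[a_1^C,a_2^C]_{TA}=([a_1,a_2]_A)^C$ and the Leibniz rule. *)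

(* Defs.v *)
From HB Require Import structures.
From mathcomp Require Import all_boot all_order all_algebra.
From mathcomp Require Import all_classical all_reals all_analysis.

Set Implicit Arguments.
Unset Strict Implicit.
Unset Printing Implicit Defensive.
Import Order.TTheory GRing.Theory Num.Theory.
Import numFieldNormedType.Exports.
Local Open Scope classical_set_scope.
Local Open Scope ring_scope.

Section Smoothness.
Context {R : realType}.

(* [U] is meant to be open in a finite-dimensional space, where this is the
   usual class C^oo. *)
Fixpoint Ck (V W : normedModType R) (k : nat) (U : set V) (f : V -> W) : Prop :=
  if k is k'.+1 then
    (forall x, U x -> differentiable f x) /\
    (forall v, Ck k' U (fun x => 'D_v f x))
  else forall x, U x -> {for x, continuous f}.

Definition smooth (V W : normedModType R) (U : set V) (f : V -> W) : Prop :=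
  forall k, Ck k U f.

End Smoothness.

(* A set [pt] with local coordinates; [param i] is the inverse of [coord i] on
   [dom i], and has arbitrary values outside the range of coordinates.  The
   points of the manifold are those of [carrier]: [pt] may contain others, which
   lets the total space of a vector bundle be carried by a plain product. *)
Record atlas (R : realType) (n : nat) := Atlas {
  pt : Type;
  chart : Type;
  dom : chart -> set pt;
  coord : chart -> pt -> 'rV[R]_n;
  param : chart -> 'rV[R]_n -> pt }.

Section Manifolds.
Context {R : realType}.

Definition carrier n (M : atlas R n) : set (pt M) :=
  \bigcup_(i : chart M) dom i.
Arguments carrier {n} M _.

Definition coords n (M : atlas R n) (i : chart M) (O : set (pt M)) :
    set 'rV[R]_n :=
  coord i @` (O `&` dom i).

Definition change n (M : atlas R n) (i j : chart M) : 'rV[R]_n -> 'rV[R]_n :=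
  coord j \o param i.

Definition open_in n (M : atlas R n) (O : set (pt M)) : Prop :=
  O `<=` carrier M /\ forall i, open (coords i O).

Record is_manifold n (M : atlas R n) : Prop := {
  coordK : forall (i : chart M) p, dom i p -> param i (coord i p) = p;
  open_overlap : forall i j : chart M, open (coords i (dom j));
  smooth_change : forall i j : chart M, smooth (coords i (dom j)) (change i j);
  manifold_hausdorff : forall p q, carrier M p -> carrier M q -> p <> q ->
    exists O O', [/\ open_in O, open_in O', O p, O' q & O `&` O' = set0];
  manifold_second_countable : exists2 C : set (chart M),
    countable C & carrier M = \bigcup_(i in C) dom i }.

Definition smooth_fun n (M : atlas R n) (O : set (pt M))
    (f : pt M -> R^o) : Prop :=
  forall i, smooth (coords i O) (f \o param i).

(* An element of a fibre over [p], given by its components in the chart (and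
   local frame) labelled [i], for all [i]. *)
Definition components n (M : atlas R n) (r : nat) := chart M -> 'rV[R]_r.

(* A rank [r] bundle trivialized over the charts, given by its transition
   matrices: the components change by  xi_j = xi_i *m g i j p. *)
Definition bundle n (M : atlas R n) (r : nat) :=
  chart M -> chart M -> pt M -> 'M[R]_r.

Record is_vector_bundle n (M : atlas R n) r (g : bundle M r) : Prop := {
  bundle_id : forall i p, dom i p -> g i i p = 1%:M;
  bundle_comp : forall i j k p, dom i p -> dom j p -> dom k p ->
    g i j p *m g j k p = g i k p;
  bundle_smooth : forall i j, smooth (coords i (dom j)) (g i j \o param i) }.

(* Components in the charts that do not contain [p] are set to 0, so that each
   element of the fibre is represented once. *)
Definition fibre n (M : atlas R n) r (g : bundle M r) (p : pt M) :
    set (components M r) :=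
  [set xi | (forall i j, dom i p -> dom j p -> xi j = xi i *m g i j p) /\
            (forall i, ~ dom i p -> xi i = 0)].

(* Only the values on [O] of a section over [O] are relevant. *)
Definition section n (M : atlas R n) r (g : bundle M r) (O : set (pt M))
    (s : pt M -> components M r) : Prop :=
  (forall p, O p -> fibre g p (s p)) /\
  (forall i, smooth (coords i O) (fun x => s (param i x) i)).

Definition tangent_bundle n (M : atlas R n) : bundle M n :=
  fun i j p => 'J (change i j) (coord i p).
Arguments tangent_bundle {n} M _ _ _.

(* In the chart [i], the action on the function [f] of the vector [v] at [p]. *)
Definition deriv n (M : atlas R n) (i : chart M) (p : pt M) (v : components M n)
    (f : pt M -> R^o) : R :=
  'D_(v i) (f \o param i) (coord i p).

Definition total n (M : atlas R n) r (g : bundle M r) : atlas R (n + r) :=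
  @Atlas R (n + r) (pt M * components M r)%type (chart M)
    (fun i => [set e | dom i e.1 /\ fibre g e.1 e.2])
    (fun i e => row_mx (coord i e.1) (e.2 i))
    (fun i z => let p := param i (lsubmx z) in
       (p, fun j => if `[< dom j p >] then rsubmx z *m g i j p else 0)).

Definition tangent_manifold n (M : atlas R n) : atlas R (n + n) :=
  total (tangent_bundle M).

(* pi_* : TA -> TM.  The fibre coordinates of pi_* are (xi, xi') and, from
   the change of coordinates xi_j = xi_i *m g of A, they change by
   xi_j = xi_i *m g,  xi'_j = xi_i *m dg(v) + xi'_i *m g  over (p, v). *)
Definition tangent_lift_bundle n (M : atlas R n) r (g : bundle M r) :
    bundle (tangent_manifold M) (r + r) :=
  fun (i j : chart M) pv =>
    block_mx (g i j pv.1)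
             ('D_(pv.2 i) (g i j \o param i : _ -> 'M[R]_r) (coord i pv.1))
             0 (g i j pv.1).

(* The preimage of [O] under TM -> M. *)
Definition tangent_over n (M : atlas R n) (O : set (pt M)) :
    set (pt (tangent_manifold M)) :=
  [set pv | O pv.1 /\ fibre (tangent_bundle M) pv.1 pv.2].

(* a^C = a_* and a^V, in the fibre coordinates (xi, xi') of pi_*.  For A = TM
   the same formulas give the components on (d/dx, d/dx') of the complete and
   vertical lifts  X^k d/dx^k + x'^h (d_h X^k) d/dx'^k  and  X^k d/dx'^k  of a
   vector field X to the manifold TM. *)
Definition complete_lift n (M : atlas R n) r (s : pt M -> components M r) :
    pt (tangent_manifold M) -> components (tangent_manifold M) (r + r) :=
  fun pv (i : chart M) =>
    if `[< dom i pv.1 >] then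
      row_mx (s pv.1 i)
        ('D_(pv.2 i) (fun x => s (param i x) i : 'rV[R]_r) (coord i pv.1))
    else 0.

Definition vertical_lift n (M : atlas R n) r (s : pt M -> components M r) :
    pt (tangent_manifold M) -> components (tangent_manifold M) (r + r) :=
  fun pv (i : chart M) => if `[< dom i pv.1 >] then row_mx 0 (s pv.1 i) else 0.

(* The charts of [M] are adapted to a foliation: the coordinates x^a are those
   with index in [tr], the y^u the others, and the leaves are x^a = const; in a
   change of chart the new x^a do not depend on the old y^u. *)
Record is_foliated_manifold n (M : atlas R n) (tr : {set 'I_n}) : Prop := {
  foliated_is_manifold : is_manifold M;
  foliated_change : forall (i j : chart M) p, dom i p -> dom j p ->
    forall u a : 'I_n, u \notin tr -> a \in tr ->
    tangent_bundle M i j p u a = 0 }.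

Definition tangent_to_leaves n (M : atlas R n) (tr : {set 'I_n}) (p : pt M) :
    set (components M n) :=
  [set v | fibre (tangent_bundle M) p v /\
           forall i, dom i p -> forall a, a \in tr -> v i ord0 a = 0].

(* TF: the leaves in TM are x^a = const, x'^a = const. *)
Definition tangent_foliation n (tr : {set 'I_n}) : {set 'I_(n + n)} :=
  [set k | match fintype.split k with
           | inl a => a \in tr
           | inr a => a \in tr
           end]%SET.

(* [bracket O] is the bracket of the local sections over the open set [O]. *)
Record algebroid_structure n (M : atlas R n) (r : nat) := AlgebroidStructure {
  anchor : pt M -> components M r -> components M n;
  bracket : set (pt M) ->
    (pt M -> components M r) -> (pt M -> components M r) ->
    (pt M -> components M r) }.

Definition anchor_section n (M : atlas R n) r (L : algebroid_structure M r)
    (s : pt M -> components M r) : pt M -> components M n :=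
  fun p => anchor L p (s p).

Record is_lie_algebroid n (M : atlas R n) r (A : bundle M r)
    (L : algebroid_structure M r) : Prop := {
  anchor_fibre : forall p xi, carrier M p -> fibre A p xi ->
    fibre (tangent_bundle M) p (anchor L p xi);
  anchor_linear : forall p (c : R) xi eta, carrier M p ->
    fibre A p xi -> fibre A p eta ->
    anchor L p (c *: xi + eta) = c *: anchor L p xi + anchor L p eta;
  anchor_smooth : forall O s, open_in O -> section A O s ->
    section (tangent_bundle M) O (anchor_section L s);
  bracket_section : forall O s t, open_in O -> section A O s ->
    section A O t -> section A O (bracket L O s t);
  bracket_local : forall O O' s t s' t', open_in O -> open_in O' ->
    O' `<=` O -> section A O s -> section A O t ->
    section A O' s' -> section A O' t' ->
    (forall p, O' p -> s p = s' p) -> (forall p, O' p -> t p = t' p) ->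
    forall p, O' p -> bracket L O s t p = bracket L O' s' t' p;
  bracket_linear : forall O (c : R) s s' t, open_in O -> section A O s ->
    section A O s' -> section A O t -> forall p, O p ->
    bracket L O (c *: s + s') t p =
      c *: bracket L O s t p + bracket L O s' t p;
  bracket_skew : forall O s t, open_in O -> section A O s -> section A O t ->
    forall p, O p -> bracket L O s t p = - bracket L O t s p;
  bracket_jacobi : forall O s t u, open_in O -> section A O s ->
    section A O t -> section A O u -> forall p, O p ->
    bracket L O s (bracket L O t u) p + bracket L O t (bracket L O u s) p
      + bracket L O u (bracket L O s t) p = 0;
  bracket_leibniz : forall O s t (f : pt M -> R^o), open_in O ->
    section A O s -> section A O t -> smooth_fun O f ->
    forall i p, O p -> dom i p ->
    bracket L O s (fun q => f q *: t q) p =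
      f p *: bracket L O s t p + deriv i p (anchor L p (s p)) f *: t p;
  anchor_bracket : forall O s t (f : pt M -> R^o), open_in O ->
    section A O s -> section A O t -> smooth_fun O f ->
    forall i p, O p -> dom i p ->
    deriv i p (anchor L p (bracket L O s t p)) f =
      deriv i p (anchor L p (s p)) (fun q => deriv i q (anchor L q (t q)) f) -
      deriv i p (anchor L p (t p)) (fun q => deriv i q (anchor L q (s q)) f) }.

Definition is_subbundle n (M : atlas R n) r (A : bundle M r)
    (B : pt M -> set (components M r)) : Prop :=
  exists m : nat, forall p, carrier M p ->
  exists O (b : 'I_m -> pt M -> components M r),
  [/\ open_in O, O p, forall k, section A O (b k),
      forall q, O q ->
        B q = [set xi | exists c : 'I_m -> R, xi = \sum_k c k *: b k q] &
      forall q, O q -> forall c : 'I_m -> R,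
        \sum_k c k *: b k q = 0 -> forall k, c k = 0].

Definition subsection n (M : atlas R n) r (A : bundle M r)
    (B : pt M -> set (components M r)) (O : set (pt M))
    (s : pt M -> components M r) : Prop :=
  section A O s /\ forall p, O p -> B p (s p).

Definition is_lie_subalgebroid n (M : atlas R n) r (A : bundle M r)
    (L : algebroid_structure M r) (B : pt M -> set (components M r)) : Prop :=
  is_subbundle A B /\
  forall O b b', open_in O -> subsection A B O b -> subsection A B O b' ->
    subsection A B O (bracket L O b b').

Definition B_foliated n (M : atlas R n) r (A : bundle M r)
    (L : algebroid_structure M r) (B : pt M -> set (components M r))
    (O : set (pt M)) (a : pt M -> components M r) : Prop :=
  section A O a /\
  forall O' b, open_in O' -> O' `<=` O -> subsection A B O' b ->
    subsection A B O' (bracket L O' b a).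

Record is_foliation_of n (M : atlas R n) (tr : {set 'I_n}) r (A : bundle M r)
    (L : algebroid_structure M r) (B : pt M -> set (components M r)) : Prop := {
  foliation_subalgebroid : is_lie_subalgebroid A L B;
  foliation_anchor : forall p, carrier M p ->
    anchor L p @` B p = tangent_to_leaves tr p;
  foliation_spanned : forall p, carrier M p ->
    exists O, [/\ open_in O, O p & forall s, section A O s ->
      exists (N : nat) (f : 'I_N -> pt M -> R^o)
             (a : 'I_N -> pt M -> components M r),
      [/\ forall k, smooth_fun O (f k),
          forall k, B_foliated A L B O (a k) &
          forall q, O q -> s q = \sum_k f k q *: a k q]] }.

(* TB, the tangent vectors of the submanifold B of A, as a subset of the
   fibres of pi_* : TA -> TM: the vectors (v, xi') tangent to A at (p, xi) that
   are velocities of smooth curves lying in B. *)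
Definition tangent_subbundle n (M : atlas R n) r (A : bundle M r)
    (B : pt M -> set (components M r)) :
    pt (tangent_manifold M) -> set (components (tangent_manifold M) (r + r)) :=
  fun pv => [set w | fibre (tangent_lift_bundle A) pv w /\
    exists (i : chart (total A)) (U : set R^o) (c : R^o -> pt (total A)),
    [/\ dom (i : chart M) pv.1 /\ open_nbhs 0 U,
        forall t, U t ->
          dom i (c t) /\ B (c t).1 (c t).2,
        smooth U (coord i \o c),
        coord i (c 0) =
          row_mx (coord (i : chart M) pv.1) (lsubmx (w i)) &
        'D_1 (coord i \o c) 0 =
          row_mx (pv.2 i) (rsubmx (w i))]].

End Manifolds.

(* The structure of the tangent Lie algebroid: together with the axioms of Lie
   algebroids, these relations determine the anchor and the bracket. *)
Record is_tangent_structure (R : realType) (n r : nat) (M : atlas R n)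
    (A : bundle M r) (L : algebroid_structure M r)
    (TL : algebroid_structure (tangent_manifold M) (r + r)) : Prop := {
  tangent_anchor_C : forall O a, open_in O -> section A O a ->
    forall pv, tangent_over O pv ->
    anchor TL pv (complete_lift a pv) = complete_lift (anchor_section L a) pv;
  tangent_anchor_V : forall O a, open_in O -> section A O a ->
    forall pv, tangent_over O pv ->
    anchor TL pv (vertical_lift a pv) = vertical_lift (anchor_section L a) pv;
  tangent_bracket_VV : forall O a1 a2, open_in O ->
    section A O a1 -> section A O a2 -> forall pv, tangent_over O pv ->
    bracket TL (tangent_over O) (vertical_lift a1) (vertical_lift a2) pv = 0;
  tangent_bracket_CV : forall O a1 a2, open_in O ->
    section A O a1 -> section A O a2 -> forall pv, tangent_over O pv ->
    bracket TL (tangent_over O) (complete_lift a1) (vertical_lift a2) pv =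
      vertical_lift (bracket L O a1 a2) pv;
  tangent_bracket_CC : forall O a1 a2, open_in O ->
    section A O a1 -> section A O a2 -> forall pv, tangent_over O pv ->
    bracket TL (tangent_over O) (complete_lift a1) (complete_lift a2) pv =
      complete_lift (bracket L O a1 a2) pv }.

(* Main.v *)
From HB Require Import structures.
From mathcomp Require Import all_boot all_order all_algebra.
From mathcomp Require Import all_classical all_reals all_analysis.
From mathcomp Require Import ring.
Require Import Defs.

(** Everything about TA and TB is tested on lifts. Over the domain of a chart a
    section of TA is a combination, with smooth functions on TM as coefficients,
    of complete and vertical lifts of sections of A. The same holds for TB and
    lifts of sections of B: a curve in B is a combination [sum_k mu_k(t) b_k] of
    a local frame of B along its projection, with smooth coefficients because
    the matrix of components of the frame has a smooth one-sided inverse, and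
    the product rule shows that its velocity is the combination of the [b_k^C]
    with coefficients [mu_k(0)] and of the [b_k^V] with coefficients [mu_k'(0)]
    ([tangent_subbundle_span], [lift_local_frame]).

    Since brackets are local and satisfy the Leibniz rule, a bracket with a
    section of TB lies in TB as soon as the brackets with the [b_k^C] and
    [b_k^V] do ([bracket_frame_mem]). For a second argument that is itself a
    lift these are lifts of brackets in A, or zero. This gives that TB is closed
    under the bracket ([tangent_lie_subalgebroid]) and that the lifts of
    B-foliated sections are TB-foliated ([foliated_lift]).

    The anchor maps lifts to lifts, and the transverse components of the vector
    fields [#b_k] vanish identically, hence also their derivatives. So the image
    of TB is tangent to the leaves, and it is all of the tangent space of the
    leaves by solving a block triangular linear system whose diagonal blocks are
    the system for B ([tangent_anchor_image]).

    If a section of A is a combination [sum_k f_k a_k] of foliated sections, its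
    lifts are [sum_k f_k a_k^V] and [sum_k (f_k a_k^C + df_k a_k^V)], so
    TB-foliated sections span the lifts of the constant frame of a chart, and
    therefore all sections of TA ([tangent_foliation_spanned]). The hypothesis
    on A concerns the sections over a given open set, whereas the constant frame
    is defined over a chart only; bump functions bridge this gap
    ([bump_section]).

    For the foliation of TM, the derivatives of the transverse coordinates of a
    change of chart are constant along the leaves because these coordinates are
    ([tangent_foliated_change]). *)

Set Implicit Arguments.
Unset Strict Implicit.
Unset Printing Implicit Defensive.
Import Order.TTheory GRing.Theory Num.Theory.
Import numFieldNormedType.Exports.
Local Open Scope classical_set_scope.
Local Open Scope ring_scope.

#[local] Arguments carrier {R n} M _.
#[local] Arguments tangent_bundle {R n} M _ _ _.

(** * Matrices and index splitting *)

Lemma split_lshift m n (k : 'I_m) : fintype.split (lshift n k) = inl k.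
Proof. exact: (unsplitK (inl k)). Qed.

Lemma split_rshift m n (k : 'I_n) : fintype.split (rshift m k) = inr k.
Proof. exact: (unsplitK (inr k)). Qed.

Lemma eq_mulmx_row (R : realType) m n (A B : 'M[R]_(m, n)) :
  (forall v : 'rV[R]_m, v *m A = v *m B) -> A = B.
Proof. by move=> H; apply/row_matrixP => i; rewrite !rowE. Qed.

Lemma sum_row_mx (R : realType) n1 n2 N (f : 'I_N -> 'rV[R]_n1)
    (g : 'I_N -> 'rV[R]_n2) :
  \sum_k row_mx (f k) (g k) = row_mx (\sum_k f k) (\sum_k g k).
Proof.
apply/rowP => a; rewrite summxE; case: (split_ordP a) => b ->.
  by rewrite row_mxEl summxE; apply: eq_bigr => k _; rewrite row_mxEl.
by rewrite row_mxEr summxE; apply: eq_bigr => k _; rewrite row_mxEr.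
Qed.

(** * Smooth maps between finite-dimensional spaces *)

Section Calculus.
Context {R : realType}.
Implicit Types V W : normedModType R.

(** The local case of [near_eq_differentiable], to which it reduces by
    subtraction: the remainder of a vanishing germ is [o(id)] trivially. *)
Lemma differentiable_near0 V W (f : V -> W) x :
  (\near x, f x = 0) -> differentiable f x.
Proof.
move=> f0; have fx : f x = 0 by exact: nbhs_singleton f0.
have E : f \o shift x = cst (f x) + (\0 : V -> W) +o_ (0 : V) id.
  apply/eqaddoP => _/posnumP[e].
  have := f0; rewrite (near_shift 0 x) => f0'.
  near=> y; rewrite [X in `|X|](_ : _ = 0) ?normr0 ?mulr_ge0//.
  rewrite /= fx !fctE /= addr0 subr0.
  have /= : ((fun x => f x = 0) \o shift (x - 0)) y by near: y.
  by rewrite subr0.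
apply/diff_locallyP.
pose L : {linear V -> W} := \0.
have D : 'd f x = L :> (V -> W).
  by apply: diff_unique => //= y; exact: cst_continuous.
by rewrite D; split => // y; exact: cst_continuous.
Unshelve. all: by end_near. Qed.

Lemma near_eq_differentiable V W (f g : V -> W) x :
  (\near x, f x = g x) -> differentiable f x -> differentiable g x.
Proof.
move=> fg df; have -> : g = f + (g - f) by rewrite addrC subrK.
apply: differentiableD => //; apply: differentiable_near0.
by near=> y; rewrite !fctE (near fg y) ?subrr//.
Unshelve. all: by end_near. Qed.

Lemma open_near_eq V W (U : set V) (f g : V -> W) x : open U -> U x ->
  (forall y, U y -> f y = g y) -> \near x, f x = g x.
Proof. by move=> oU Ux fg; near=> y; apply: fg; near: y; exact: open_nbhs_nbhs.
Unshelve. all: by end_near. Qed.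

Lemma Ck_sub V W k (U U' : set V) (f : V -> W) :
  U' `<=` U -> Ck k U f -> Ck k U' f.
Proof.
move=> sU; elim: k f => [|k IH] f /=; first by move=> Cf x /sU/Cf.
by move=> [df Df]; split=> [x /sU/df//|v]; exact: IH.
Qed.

(** Both clauses of [Ck] see a function only through its germs; all the closure
    properties below compute a derivative on [U] and conclude by this lemma. *)
Lemma Ck_eq V W k (U : set V) (f g : V -> W) :
  open U -> (forall x, U x -> f x = g x) -> Ck k U f -> Ck k U g.
Proof.
move=> oU; elim: k f g => [|k IH] f g fg /=.
  move=> Cf x Ux; rewrite /prop_for /continuous_at -fg//.
  by apply: cvg_trans (Cf x Ux); apply: near_eq_cvg; exact: open_near_eq fg.
move=> [df Df]; split=> [x Ux|v].
  by apply: near_eq_differentiable (df x Ux); exact: open_near_eq fg.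
apply: IH (Df v) => x Ux; apply: near_eq_derive; exact: open_near_eq fg.
Qed.

Lemma CkS V W k (U : set V) (f : V -> W) : Ck k.+1 U f -> Ck k U f.
Proof.
elim: k f => [|k IH] f /=.
  by move=> [df _] x Ux; exact: differentiable_continuous (df x Ux).
by move=> [df Df]; split=> // v; exact: IH.
Qed.

Lemma Ck_local V W k (U : set V) (f : V -> W) :
  (forall x, U x -> exists O, [/\ open O, O x & Ck k O f]) -> Ck k U f.
Proof.
elim: k f => [|k IH] f /= H.
  by move=> x /H[Q [_ Ox]]; apply.
split=> [x /H[Q [_ Ox [+ _]]]|v]; first by apply.
by apply: IH => x /H[Q [oQ Qx [_ Df]]]; exists Q.
Qed.

Lemma Ck_cst V W k (U : set V) (c : W) : Ck k U (fun=> c : W).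
Proof.
elim: k c => [|k IH] c /=; first by move=> x _; exact: cvg_cst.
split=> [x _|v]; first exact: differentiable_cst.
have -> : 'D_v (fun=> c : W) = (fun=> 0) :> (V -> W); last exact: IH.
by apply/funext => x; exact: derive_cst.
Qed.

Lemma Ck_linear V W k (U : set V) (f : {linear V -> W}) :
  continuous f -> Ck k U f.
Proof.
move=> cf; case: k => [|k] /=; first by move=> x _; exact: cf.
split=> [x _|v]; first exact: linear_differentiable.
have -> : 'D_v f = (fun=> f v) :> (V -> W); last exact: Ck_cst.
apply/funext => x; rewrite deriveE; last exact: linear_differentiable.
by rewrite diff_lin.
Qed.

Lemma CkD V W k (U : set V) (f g : V -> W) : open U ->
  Ck k U f -> Ck k U g -> Ck k U (fun x => f x + g x).
Proof.
move=> oU; elim: k f g => [|k IH] f g /=.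
  by move=> Cf Cg x Ux; apply: cvgD; [exact: Cf|exact: Cg].
move=> [df Df] [dg Dg]; split=> [x Ux|v].
  by apply: differentiableD; [exact: df|exact: dg].
apply: (Ck_eq oU) (IH _ _ (Df v) (Dg v)) => x Ux.
by rewrite [RHS]deriveD//; apply: diff_derivable; [exact: df|exact: dg].
Qed.

Lemma Ck_sum V W k (U : set V) (I : Type) (s : seq I) (P : pred I)
    (f : I -> V -> W) : open U ->
  (forall i, Ck k U (f i)) -> Ck k U (fun x => \sum_(i <- s | P i) f i x).
Proof.
move=> oU Cf; elim: s => [|i s IH].
  rewrite (_ : (fun x => _) = fun=> 0); first exact: Ck_cst.
  by apply/funext => x; rewrite big_nil.
have [Pi|Pi] := boolP (P i).
  rewrite (_ : (fun x => _) = fun x => f i x + \sum_(j <- s | P j) f j x).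
    exact: CkD.
  by apply/funext => x; rewrite big_cons Pi.
rewrite (_ : (fun x => _) = fun x => \sum_(j <- s | P j) f j x)//.
by apply/funext => x; rewrite big_cons (negbTE Pi).
Qed.

Lemma derive_lin_comp V W W' (f : V -> W) (L : {linear W -> W'}) x v :
  continuous L -> differentiable f x -> 'D_v (L \o f) x = L ('D_v f x).
Proof.
move=> cL df; have dL y : differentiable L y by exact: linear_differentiable.
rewrite !deriveE//; last exact: differentiable_comp.
by rewrite diff_comp// /comp (diff_lin _ cL).
Qed.

Lemma Ck_lin_comp V W W' k (U : set V) (f : V -> W) (L : {linear W -> W'}) :
  open U -> continuous L -> Ck k U f -> Ck k U (L \o f).
Proof.
move=> oU cL; elim: k f => [|k IH] f /=.
  by move=> Cf x Ux; apply: continuous_comp; [exact: Cf|exact: cL].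
move=> [df Df]; split=> [x Ux|v].
  by apply: differentiable_comp; [exact: df|exact: linear_differentiable].
apply: (Ck_eq oU) (IH _ (Df v)) => x Ux.
by rewrite derive_lin_comp//; exact: df.
Qed.

Section Scale.
Variables V W : normedModType R.

Fact scale_is_bilinear : bilinear_for
  (GRing.Scale.Law.clone _ _ *:%R _) (GRing.Scale.Law.clone _ _ *:%R _)
  (@GRing.scale R W : R^o -> W -> W).
Proof.
split=> [w|c] a x y /=; first by rewrite scalerDl scalerA.
by rewrite scalerDr !scalerA mulrC.
Qed.
HB.instance Definition _ := bilinear_isBilinear.Build R R^o W W _ _
  (@GRing.scale R W : R^o -> W -> W) scale_is_bilinear.

Let scale_cont : continuous (fun p : R^o * W => p.1 *: p.2).
Proof. exact: scale_continuous. Qed.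

Lemma differentiable_scale (f : V -> R^o) (g : V -> W) x :
  differentiable f x -> differentiable g x ->
  differentiable (fun y => f y *: g y) x.
Proof.
move=> df dg; apply: (@differentiable_comp _ _ _ _ (fun y => (f y, g y))
  (fun p : R^o * W => p.1 *: p.2)); first exact: differentiable_pair.
exact: (@differentiable_bilin _ _ _ _ (@GRing.scale R W : R^o -> W -> W)).
Qed.

Lemma derive_scale (f : V -> R^o) (g : V -> W) x v :
  differentiable f x -> differentiable g x ->
  'D_v (fun y => f y *: g y) x = f x *: 'D_v g x + 'D_v f x *: g x.
Proof.
move=> df dg; rewrite deriveE; last exact: differentiable_scale.
rewrite (@diff_comp _ _ _ _ (fun y => (f y, g y))
  (fun p : R^o * W => p.1 *: p.2)); last 2 first.
- exact: differentiable_pair.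
- exact: (@differentiable_bilin _ _ _ _ (@GRing.scale R W : R^o -> W -> W)).
rewrite (@diff_bilin _ _ _ _ (@GRing.scale R W : R^o -> W -> W))//=.
by rewrite diff_pair//= !deriveE.
Qed.

Lemma CkZ k (U : set V) (f : V -> R^o) (g : V -> W) : open U ->
  Ck k U f -> Ck k U g -> Ck k U (fun x => f x *: g x).
Proof.
move=> oU; elim: k f g => [|k IH] f g.
  by move=> /= Cf Cg x Ux; apply: cvgZ; [exact: Cf|exact: Cg].
move=> Cf Cg; have /= [df Df] := Cf; have /= [dg Dg] := Cg.
split=> [x Ux|v].
  by apply: differentiable_scale; [exact: df|exact: dg].
apply: (Ck_eq oU) (CkD oU (IH _ _ (CkS Cf) (Dg v)) (IH _ _ (Df v) (CkS Cg))).
by move=> x Ux; rewrite [RHS]derive_scale//; [exact: df|exact: dg].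
Qed.

End Scale.

Section MatrixEntries.
Variables (m n : nat) (V : normedModType R).
Implicit Type f : V -> 'M[R]_(m, n).

Definition entry i j (A : 'M[R]_(m, n)) : R^o := A i j.
Fact entry_is_linear i j : linear (entry i j).
Proof. by move=> c A B; rewrite /entry !mxE. Qed.
HB.instance Definition _ i j :=
  GRing.isLinear.Build R 'M[R]_(m, n) R^o _ (entry i j) (entry_is_linear i j).
Lemma entry_continuous i j : continuous (entry i j).
Proof. exact: coord_continuous. Qed.

Lemma Ck_entry k U f i j :
  open U -> Ck k U f -> Ck k U (fun x => f x i j : R^o).
Proof.
move=> oU; exact: (Ck_lin_comp (L := entry i j) oU (@entry_continuous i j)).
Qed.

Lemma differentiable_mx f x :
  (forall i j, differentiable (fun y => f y i j : R^o) x) -> differentiable f x.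
Proof.
move=> df.
have -> : f = \sum_i \sum_j (fun y => f y i j *: delta_mx i j).
  apply/funext => y; rewrite {1}[f y]matrix_sum_delta fct_sumE.
  by apply: eq_bigr => i _; rewrite fct_sumE.
apply: differentiable_sum => i; apply: differentiable_sum => j.
exact: differentiableZl.
Qed.

(** Derivatives of matrix-valued maps are taken entrywise, so that the
    smoothness of every polynomial matrix operation reduces to scalars. *)
Lemma Ck_mx k U f : open U ->
  (forall i j, Ck k U (fun x => f x i j : R^o)) -> Ck k U f.
Proof.
move=> oU; elim: k f => [|k IH] f Cf.
  move=> x Ux; apply/cvg_mx_entourageP => A entA.
  suff: \forall y \near x, forall p : 'I_m * 'I_n, A (f x p.1 p.2, f y p.1 p.2).
    by apply: filterS => y H i j; apply/mem_set; exact: (H (i, j)).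
  apply: filter_forall => -[i j].
  have := Cf i j x Ux => /cvg_entourageP; exact.
have df : forall x, U x -> differentiable f x.
  by move=> x Ux; apply: differentiable_mx => i j; have [+ _] := Cf i j; apply.
split=> // v; apply: (@Ck_eq _ _ _ _
  (fun x => \matrix_(i, j) 'D_v (fun y => f y i j : R^o) x)) => //.
  by move=> x Ux; rewrite derive_mx//; exact/diff_derivable/df.
apply: IH => i j; have [_ /(_ v)] := Cf i j.
by apply: Ck_eq => // x Ux; rewrite mxE.
Qed.

Lemma derive_entry f x v i j : differentiable f x ->
  ('D_v f x) i j = 'D_v (fun y => f y i j : R^o) x.
Proof. by move=> df; rewrite derive_mx ?mxE//; exact: diff_derivable. Qed.

End MatrixEntries.

Lemma derive_comp V V' W (f : V -> V') (g : V' -> W) x v :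
  differentiable f x -> differentiable g (f x) ->
  'D_v (g \o f) x = 'D_('D_v f x) g (f x).
Proof.
move=> df dg; rewrite !deriveE//; last exact: differentiable_comp.
by rewrite diff_comp.
Qed.

(** In a basis of the intermediate space the chain rule is a sum of products
    [c_i (D_v f) * (D_(e_i) g \o f)], whose factors are covered by induction. A
    basis is needed because [Ck] differentiates in constant directions only. *)
Lemma Ck_comp V V' W k (U : set V) (O : set V') (f : V -> V') (g : V' -> W)
    m (e : 'I_m -> V') (c : 'I_m -> {linear V' -> R^o}) :
  (forall i, continuous (c i)) -> (forall v, v = \sum_i c i v *: e i) ->
  open U -> open O -> (forall x, U x -> O (f x)) ->
  Ck k U f -> Ck k O g -> Ck k U (g \o f).
Proof.
move=> cc ce oU oO fO; elim: k g => [|k IH] g Cf Cg.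
  by move=> x Ux; apply: continuous_comp; [exact: Cf|exact/Cg/fO].
have /= [df Df] := Cf; have /= [dg Dg] := Cg.
split=> [x Ux|v].
  by apply: differentiable_comp; [exact: df|exact/dg/fO].
apply: (Ck_eq oU (f := fun x => \sum_i c i ('D_v f x) *: 'D_(e i) g (f x))).
  move=> x Ux; rewrite derive_comp; [|exact: df|exact/dg/fO].
  rewrite [in RHS](ce ('D_v f x)) [RHS]deriveE; last exact/dg/fO.
  rewrite linear_sum; apply: eq_bigr => i _.
  by rewrite linearZ/= -deriveE//; exact/dg/fO.
apply: Ck_sum => // i; apply: CkZ => //; first exact: Ck_lin_comp (cc i) (Df v).
exact: IH (CkS Cf) (Dg _).
Qed.

Definition rv_basis n (i : 'I_n) : 'rV[R]_n := delta_mx 0 i.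
Definition rv_coord n (i : 'I_n) : {linear 'rV[R]_n -> R^o} := entry 0 i.

Lemma rv_basisE n (v : 'rV[R]_n) : v = \sum_i rv_coord i v *: rv_basis i.
Proof. exact: row_sum_delta. Qed.

Lemma smooth_sub V W (U U' : set V) (f : V -> W) :
  U' `<=` U -> smooth U f -> smooth U' f.
Proof. by move=> sU Cf k; exact: Ck_sub (Cf k). Qed.

Lemma smooth_eq V W (U : set V) (f g : V -> W) :
  open U -> (forall x, U x -> f x = g x) -> smooth U f -> smooth U g.
Proof. by move=> oU fg Cf k; exact: Ck_eq (Cf k). Qed.

Lemma smooth_local V W (U : set V) (f : V -> W) :
  (forall x, U x -> exists O, [/\ open O, O x & smooth O f]) -> smooth U f.
Proof.
move=> H k; apply: Ck_local => x /H[Q [oQ Qx Cf]].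
by exists Q; split=> //; exact: Cf.
Qed.

Lemma smooth_cst V W (U : set V) (c : W) : smooth U (fun=> c : W).
Proof. by move=> k; exact: Ck_cst. Qed.

Lemma smooth_linear V W (U : set V) (f : {linear V -> W}) :
  continuous f -> smooth U f.
Proof. by move=> cf k; exact: Ck_linear. Qed.

Lemma smoothD V W (U : set V) (f g : V -> W) : open U ->
  smooth U f -> smooth U g -> smooth U (fun x => f x + g x).
Proof. by move=> oU Cf Cg k; exact: CkD. Qed.

Lemma smooth_sum V W (U : set V) (I : Type) (s : seq I) (P : pred I)
    (f : I -> V -> W) : open U ->
  (forall i, smooth U (f i)) -> smooth U (fun x => \sum_(i <- s | P i) f i x).
Proof. by move=> oU Cf k; apply: Ck_sum => // i; exact: Cf. Qed.

Lemma smoothZ V W (U : set V) (f : V -> R^o) (g : V -> W) : open U ->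
  smooth U f -> smooth U g -> smooth U (fun x => f x *: g x).
Proof. by move=> oU Cf Cg k; exact: CkZ. Qed.

Lemma smoothM V (U : set V) (f g : V -> R^o) : open U ->
  smooth U f -> smooth U g -> smooth U (fun x => f x * g x : R^o).
Proof. by move=> oU Cf Cg; exact: smoothZ. Qed.

Lemma smooth_prod V (U : set V) (I : Type) (s : seq I) (P : pred I)
    (f : I -> V -> R^o) : open U ->
  (forall i, smooth U (f i)) ->
  smooth U (fun x => \prod_(i <- s | P i) f i x : R^o).
Proof.
move=> oU Cf; elim: s => [|i s IH].
  apply: (@smooth_eq _ _ _ (fun=> 1 : R^o)) => //; last exact: smooth_cst.
  by move=> x _; rewrite big_nil.
have [Pi|Pi] := boolP (P i).
  refine (smooth_eq oU _ (smoothM oU (Cf i) IH)) => x _.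
  by rewrite big_cons Pi.
by refine (smooth_eq oU _ IH) => x _; rewrite big_cons (negbTE Pi).
Qed.

Lemma smooth_entry V m n (U : set V) (f : V -> 'M[R]_(m, n)) i j : open U ->
  smooth U f -> smooth U (fun x => f x i j : R^o).
Proof. by move=> oU Cf k; exact: Ck_entry. Qed.

Lemma smooth_mx V m n (U : set V) (f : V -> 'M[R]_(m, n)) : open U ->
  (forall i j, smooth U (fun x => f x i j : R^o)) -> smooth U f.
Proof. by move=> oU Cf k; apply: Ck_mx => // i j; exact: Cf. Qed.

Lemma smooth_mulmx V m n p (U : set V) (f : V -> 'M[R]_(m, n))
    (g : V -> 'M[R]_(n, p)) : open U ->
  smooth U f -> smooth U g -> smooth U (fun x => f x *m g x).
Proof.
move=> oU Cf Cg; apply: smooth_mx => // i j.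
apply: (smooth_eq oU (f := fun x => \sum_k f x i k * g x k j)).
  by move=> x _; rewrite mxE.
by apply: smooth_sum => // k; apply: smoothM => //; exact: smooth_entry.
Qed.

Lemma smooth_comp V W n (U : set V) (O : set 'rV[R]_n) (f : V -> 'rV[R]_n)
    (g : 'rV[R]_n -> W) : open U -> open O -> (forall x, U x -> O (f x)) ->
  smooth U f -> smooth O g -> smooth U (fun x => g (f x)).
Proof.
move=> oU oO fO Cf Cg k.
apply: (Ck_comp (O := O) (e := @rv_basis n) (c := @rv_coord n)) => //.
- by move=> i; exact: entry_continuous.
- exact: rv_basisE.
Qed.

Lemma smooth_comp_scalar V W (U : set V) (O : set R^o) (f : V -> R^o)
    (g : R^o -> W) : open U -> open O -> (forall x, U x -> O (f x)) ->
  smooth U f -> smooth O g -> smooth U (fun x => g (f x)).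
Proof.
move=> oU oO fO Cf Cg k.
apply: (Ck_comp (O := O) (m := 1) (e := fun=> 1 : R^o) (c := fun=> idfun)) =>
  //.
  by move=> i x; exact: cvg_id.
by move=> v; rewrite big_ord1 /= /GRing.scale/= mulr1.
Qed.

Lemma smooth_differentiable V W (U : set V) (f : V -> W) x :
  smooth U f -> U x -> differentiable f x.
Proof. by move=> /(_ 1%N)[+ _]; exact. Qed.

Lemma smooth_derive V W (U : set V) (f : V -> W) v :
  smooth U f -> smooth U (fun x => 'D_v f x).
Proof. by move=> Cf k; have [_] := Cf k.+1; exact. Qed.

Lemma smooth_continuous V W (U : set V) (f : V -> W) x :
  smooth U f -> U x -> {for x, continuous f}.
Proof. by move=> /(_ 0%N); exact. Qed.

(** The direction may vary smoothly, since the derivative is linear in it: this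
    is the smoothness of [(x, v) |-> D_v f x] used for functions on TM. *)
Lemma smooth_derive_along V W n (U : set V) (O : set 'rV[R]_n)
    (f : 'rV[R]_n -> W) (g h : V -> 'rV[R]_n) : open U -> open O ->
  (forall x, U x -> O (g x)) -> smooth O f -> smooth U g -> smooth U h ->
  smooth U (fun x => 'D_(h x) f (g x)).
Proof.
move=> oU oO gO Cf Cg Ch.
apply: (smooth_eq oU (f := fun x => \sum_i h x 0 i *: 'D_(rv_basis i) f (g x))).
  move=> x Ux; have df := smooth_differentiable Cf (gO _ Ux).
  rewrite [in RHS](rv_basisE (h x)) [RHS]deriveE// linear_sum.
  by apply: eq_bigr => i _; rewrite linearZ/= -deriveE.
apply: smooth_sum => // i; apply: smoothZ => //; first exact: smooth_entry.
exact: (smooth_comp oU oO gO Cg (smooth_derive _ Cf)).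
Qed.

Lemma derive_mulmx V m n p (f : V -> 'M[R]_(m, n))
    (g : V -> 'M[R]_(n, p)) x v : differentiable f x -> differentiable g x ->
  'D_v (fun y => f y *m g y) x = 'D_v f x *m g x + f x *m 'D_v g x.
Proof.
move=> df dg.
have de i j k : differentiable (fun y => f y i k *: (g y k j : R^o)) x.
  by apply: differentiable_scale;
    exact: (differentiable_comp _ (differentiable_coord _ _ _)).
have E i j y : (f y *m g y) i j = (\sum_k (fun y => f y i k *: (g y k j : R^o)))
  y.
  by rewrite mxE fct_sumE.
have dm : differentiable (fun y => f y *m g y) x.
  apply: differentiable_mx => i j; rewrite (_ : (fun y => _) =
    \sum_k (fun y => f y i k *: (g y k j : R^o))); last exact/funext/E.
  exact: differentiable_sum.
apply/matrixP => i j; rewrite derive_entry//.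
rewrite (_ : (fun y => _) = \sum_k (fun y => f y i k *: (g y k j : R^o)));
  last exact/funext/E.
rewrite derive_sum; last by move=> k; exact: diff_derivable.
rewrite !mxE -big_split/=; apply: eq_bigr => k _.
rewrite derive_scale;
  try exact: (differentiable_comp _ (differentiable_coord _ _ _)).
by rewrite !derive_entry// addrC.
Qed.

End Calculus.

(** * Smooth matrices, inverses and bump functions *)

Section SmoothMatrices.
Context {R : realType}.
Implicit Types V W : normedModType R.

Lemma derive_row_mx V m n1 n2
    (f : V -> 'M[R]_(m, n1)) (g : V -> 'M[R]_(m, n2)) x v :
  differentiable f x -> differentiable g x ->
  differentiable (fun y => row_mx (f y) (g y)) x /\
  'D_v (fun y => row_mx (f y) (g y)) x = row_mx ('D_v f x) ('D_v g x).
Proof.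
move=> df dg.
have El i k : (fun y => row_mx (f y) (g y) i (lshift n2 k)) =
  (fun y => f y i k).
  by apply/funext => y; rewrite row_mxEl.
have Er i k : (fun y => row_mx (f y) (g y) i (rshift n1 k)) =
  (fun y => g y i k).
  by apply/funext => y; rewrite row_mxEr.
have D : differentiable (fun y => row_mx (f y) (g y)) x.
  apply: differentiable_mx => i j; case: (split_ordP j) => k ->.
    by rewrite El; exact: (differentiable_comp df (differentiable_coord _ _ _)).
  by rewrite Er; exact: (differentiable_comp dg (differentiable_coord _ _ _)).
split=> //; apply/matrixP => i j; rewrite derive_entry//.
case: (split_ordP j) => k ->.
  by rewrite El row_mxEl derive_entry.
by rewrite Er row_mxEr derive_entry.
Qed.

Lemma smoothV V (U : set V) (f : V -> R^o) : open U ->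
  (forall x, U x -> f x != 0) -> smooth U f ->
  smooth U (fun x => (f x)^-1 : R^o).
Proof.
move=> oU f0 Cf; elim => [|k IH].
  move=> x Ux; apply: cvgV; first exact: f0.
  exact: (smooth_continuous Cf Ux).
have df x : U x -> differentiable f x by exact: smooth_differentiable.
split=> [x Ux|v]; first by apply: differentiableV; [exact: df|exact: f0].
apply: (Ck_eq oU (f := fun x =>
  (- ((f x)^-1 * (f x)^-1) : R^o) *: ('D_v f x : R^o))).
  move=> x Ux; rewrite [RHS]deriveV; last 2 first.
  - exact: f0.
  - exact/diff_derivable/df.
  by rewrite -exprVn expr2.
apply: CkZ => //; last exact: (smooth_derive v Cf).
apply: (Ck_eq oU (f := fun x => (-1 : R^o) *: ((f x)^-1 *: (f x)^-1 : R^o))).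
  by move=> x _; rewrite scaleN1r.
by apply: CkZ => //; [exact: Ck_cst|exact: CkZ].
Qed.

Lemma smooth_det V n (U : set V) (f : V -> 'M[R]_n) : open U ->
  smooth U f -> smooth U (fun x => \det (f x) : R^o).
Proof.
move=> oU Cf; rewrite /determinant; apply: smooth_sum => // s.
apply: smoothM => //; first exact: smooth_cst.
by apply: smooth_prod => // i; exact: smooth_entry.
Qed.

Lemma smooth_adj V n (U : set V) (f : V -> 'M[R]_n) : open U ->
  smooth U f -> smooth U (fun x => \adj (f x)).
Proof.
move=> oU Cf; apply: smooth_mx => // i j.
apply: (@smooth_eq _ _ _ _
  (fun x => (-1) ^+ (j + i) * \det (row' j (col' i (f x))) : R^o)) => //.
  by move=> x _; rewrite mxE.
apply: smoothM => //; first exact: smooth_cst.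
apply: smooth_det => //; apply: smooth_mx => // a b.
apply: (@smooth_eq _ _ _ _ (fun x => f x (lift j a) (lift i b) : R^o)) => //.
  by move=> x _; rewrite !mxE.
exact: smooth_entry.
Qed.

Lemma smooth_row_mx V m n1 n2 (U : set V) (f : V -> 'M[R]_(m, n1))
    (g : V -> 'M[R]_(m, n2)) : open U ->
  smooth U f -> smooth U g -> smooth U (fun x => row_mx (f x) (g x)).
Proof.
move=> oU Cf Cg; apply: smooth_mx => // i j; case: (split_ordP j) => k ->.
  apply: (@smooth_eq _ _ _ _ (fun x => f x i k : R^o)) => //.
    by move=> x _; rewrite row_mxEl.
  exact: smooth_entry.
apply: (@smooth_eq _ _ _ _ (fun x => g x i k : R^o)) => //.
  by move=> x _; rewrite row_mxEr.
exact: smooth_entry.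
Qed.

Lemma smooth_col_mx V m1 m2 n (U : set V) (f : V -> 'M[R]_(m1, n))
    (g : V -> 'M[R]_(m2, n)) : open U ->
  smooth U f -> smooth U g -> smooth U (fun x => col_mx (f x) (g x)).
Proof.
move=> oU Cf Cg; apply: smooth_mx => // i j; case: (split_ordP i) => k ->.
  apply: (@smooth_eq _ _ _ _ (fun x => f x k j : R^o)) => //.
    by move=> x _; rewrite col_mxEu.
  exact: smooth_entry.
apply: (@smooth_eq _ _ _ _ (fun x => g x k j : R^o)) => //.
  by move=> x _; rewrite col_mxEd.
exact: smooth_entry.
Qed.

Lemma smooth_block_mx V m1 m2 n1 n2 (U : set V) (f : V -> 'M[R]_(m1, n1))
    (g : V -> 'M[R]_(m1, n2)) (h : V -> 'M[R]_(m2, n1))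
    (k : V -> 'M[R]_(m2, n2)) : open U ->
  smooth U f -> smooth U g -> smooth U h -> smooth U k ->
  smooth U (fun x => block_mx (f x) (g x) (h x) (k x)).
Proof.
by move=> oU Cf Cg Ch Ck; apply: smooth_col_mx => //; apply: smooth_row_mx.
Qed.

Lemma smooth_lsubmx V m n1 n2 (U : set V) (f : V -> 'M[R]_(m, n1 + n2)) :
  open U -> smooth U f -> smooth U (fun x => lsubmx (f x)).
Proof.
move=> oU Cf; apply: smooth_mx => // i j.
apply: (@smooth_eq _ _ _ _ (fun x => f x i (lshift n2 j) : R^o)) => //.
  by move=> x _; rewrite mxE.
exact: smooth_entry.
Qed.

Lemma smooth_rsubmx V m n1 n2 (U : set V) (f : V -> 'M[R]_(m, n1 + n2)) :
  open U -> smooth U f -> smooth U (fun x => rsubmx (f x)).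
Proof.
move=> oU Cf; apply: smooth_mx => // i j.
apply: (@smooth_eq _ _ _ _ (fun x => f x i (rshift n1 j) : R^o)) => //.
  by move=> x _; rewrite mxE.
exact: smooth_entry.
Qed.

Lemma smooth_id V (U : set V) : smooth U (fun x : V => x).
Proof. by apply: (@smooth_linear _ _ _ _ idfun) => x; exact: cvg_id. Qed.

Lemma smooth_lsubmx_id m n (U : set 'rV[R]_(m + n)) : open U ->
  smooth U (fun z : 'rV[R]_(m + n) => lsubmx z).
Proof. by move=> oU; apply: smooth_lsubmx => //; exact: smooth_id. Qed.

Lemma smooth_rsubmx_id m n (U : set 'rV[R]_(m + n)) : open U ->
  smooth U (fun z : 'rV[R]_(m + n) => rsubmx z).
Proof. by move=> oU; apply: smooth_rsubmx => //; exact: smooth_id. Qed.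

Lemma open_preimage V W (U : set V) (O : set W) (f : V -> W) :
  open U -> open O -> smooth U f -> open [set x | U x /\ O (f x)].
Proof.
move=> oU oO Cf; rewrite openE => x [Ux Ofx]; rewrite /interior.
near=> y; split; near: y; first exact: open_nbhs_nbhs.
apply: (smooth_continuous Cf Ux) => /=; exact: open_nbhs_nbhs.
Unshelve. all: by end_near. Qed.

(** With [G0] a right inverse at [x0], the square matrix [b x *m G0] is
    invertible near [x0], and its inverse is smooth by Cramer's rule. *)
Lemma smooth_right_inverse V m r (U : set V) (b : V -> 'M[R]_(m, r)) x0 :
  open U -> U x0 -> smooth U b -> row_free (b x0) ->
  exists O (G : V -> 'M[R]_(r, m)),
    [/\ open O, O x0, O `<=` U, smooth O G & forall x, O x ->
      b x *m G x = 1%:M].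
Proof.
move=> oU Ux0 Cb /row_freeP[G0 bG0].
pose A x := b x *m G0.
have CA : smooth U A by apply: smooth_mulmx => //; exact: smooth_cst.
pose O := [set x | U x /\ [set y : R^o | y != 0] (\det (A x))].
have oO : open O.
  exact: open_preimage oU (@open_neq R^o 0) (smooth_det oU CA).
have OU : O `<=` U by move=> x [].
exists O, (fun x => G0 *m ((\det (A x))^-1 *: \adj (A x))); split=> //.
- by split=> //; rewrite /= /A bG0 det1 oner_neq0.
- have CO := smooth_sub OU CA.
  apply: smooth_mulmx => //; first exact: smooth_cst.
  apply: smoothZ => //; last exact: smooth_adj.
  by apply: smoothV => //; [by move=> x []|exact: smooth_det].
move=> x [Ux /= d0]; rewrite mulmxA -/(A x) -scalemxAr mul_mx_adj.
by rewrite scale_scalar_mx mulVf.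
Qed.

(** The functions [t^-n exp(-1/t)], extended by 0: a family stable under
    differentiation that contains the classical flat function ([n = 0]). *)
Definition flat (n : nat) (t : R) : R :=
  if 0 < t then t^-1 ^+ n * expR (- t^-1) else 0.

Lemma flat_ge0 n t : 0 <= flat n t.
Proof.
rewrite /flat; case: ifPn => // t0.
by rewrite mulr_ge0 ?expR_ge0// exprn_ge0// invr_ge0 ltW.
Qed.

(** From [exp y >= y^k / k!] with [y = 1/t] and [k = n + 2]: every [flat n] is
    [O(t^2)] at 0, hence has derivative 0 there. *)
Lemma flat_le n t : 0 <= t -> flat n t <= (n.+2)`!%:R * t ^+ 2.
Proof.
move=> t0; rewrite /flat; case: ifPn => [{}t0|_]; last first.
  by rewrite mulr_ge0// sqr_ge0.
have t10 : 0 < t^-1 by rewrite invr_gt0.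
rewrite expRN ler_pdivrMr ?expR_gt0//.
apply: (@le_trans _ _ ((n.+2)`!%:R * t ^+ 2 * (t^-1 ^+ n.+2 / n.+2`!%:R)));
  last first.
  apply: ler_wpM2l; first by rewrite mulr_ge0// sqr_ge0.
  by apply: le_trans (expR_ge1Dxn n.+1 (ltW t10)); rewrite lerDr.
rewrite le_eqVlt; apply/orP; left; apply/eqP.
have f0 : n.+2`!%:R != 0 :> R by rewrite pnatr_eq0 -lt0n fact_gt0.
have tn0 : t != 0 by rewrite gt_eqF.
rewrite -(addn2 n) in f0 *; rewrite exprD mulrACA (mulrC _ (_ / _)).
rewrite -[RHS]mulrA [X in _ * X]mulrC.
rewrite [RHS]mulrACA.
rewrite exprVn expr2; field.
by rewrite f0 tn0 expf_neq0.
Qed.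

Lemma is_derive_flat n (t : R) :
  is_derive t 1 (flat n) (- n%:R * flat n.+1 t + flat n.+2 t).
Proof.
have [t0|t0|->] := ltgtP t 0.
- have -> : - n%:R * flat n.+1 t + flat n.+2 t = 0.
    by rewrite /flat ltNge (ltW t0)/= mulr0 addr0.
  have H : is_derive t 1 (cst 0 : R -> R) 0 by exact: is_derive_cst.
  apply: near_eq_is_derive H; near=> s; rewrite /flat ifF//; apply/negbTE;
    rewrite -leNgt ltW//.
  by near: s; exact: lt_nbhsl.
- pose g (s : R) : R := s^-1 ^+ n * expR (- s^-1).
  suff H : is_derive t 1 g (- n%:R * flat n.+1 t + flat n.+2 t).
    apply: near_eq_is_derive H; near=> s; rewrite /flat ifT//; near: s;
      exact: lt_nbhsr.
  rewrite /flat t0.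
  have tn0 : t != 0 by rewrite gt_eqF.
  have dV : is_derive (t : R) 1 (fun y : R => y^-1) (- t ^- 2 *: 1).
    by apply: (@is_deriveV _ id) => //; exact: is_derive_id.
  have dk (u : R) : is_derive u 1 (fun s : R => s ^+ n * expR (- s))
      (u ^+ n * (expR (- u) * -1) + expR (- u) * ((n%:R * u ^+ n.-1) * 1)).
    have DN : is_derive u 1 (fun s : R => - s) (- 1 : R).
      by apply: is_deriveN; exact: is_derive_id.
    have D2 : is_derive u 1 (expR \o (fun s : R => - s)) (expR (- u) * -1).
      exact: is_derive1_comp.
    have D1 : is_derive u 1 ((id : R -> R) ^+ n) ((n%:R * u ^+ n.-1) *: 1).
      by apply: is_deriveX; exact: is_derive_id.
    have := is_deriveM D1 D2; rewrite exprfctE; exact.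
  have := is_derive1_comp (dk _) dV.
  move=> H; apply: is_derive_eq H _; clear.
  rewrite /GRing.scale/= !mulr1 !mulrN1 -exprVn.
  move: (expR _) => e; move: (t^-1) => s; case: n => [|n] /=;
    first by rewrite !mul0r; ring.
  move: (n.+1%:R) => c; rewrite !exprS; ring.
- rewrite /flat ltxx mulr0 addr0.
  set f := flat n.
  have Q : (fun h : R => h^-1 *: (f (h *: 1 + 0) - f 0)) @ (0 : R)^' -->
    (0 : R).
    apply/norm_cvg0P.
    pose C : R := n.+2`!%:R.
    apply: (@squeeze_cvgr _ _ _ _ (cst 0) (fun h => C * `|h|)); last 2 first.
    + exact: cvg_cst.
    + rewrite -[X in _ --> X](mulr0 C); apply: cvgMr.
      rewrite -[X in _ --> X](@normr0 _ R).
      apply: cvg_norm; apply: cvg_within_filter; exact: cvg_id.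
    near=> h; rewrite normr_ge0/=.
    have h0 : h != 0 by near: h; exact: nbhs_dnbhs_neq.
    rewrite /f {2}/flat ltxx subr0 addr0 [h *: 1]mulr1.
    rewrite normrM normfV ler_pdivrMl ?normr_gt0//.
    rewrite ger0_norm ?flat_ge0//.
    have [hp|hn] := leP 0 h.
      rewrite ger0_norm//; apply: le_trans (flat_le n hp) _.
      by rewrite expr2 mulrCA.
    rewrite /flat ltNge (ltW hn)/= mulr_ge0// mulr_ge0//.
  by apply: DeriveDef; [apply/cvg_ex; exists 0|exact: cvg_lim].
Unshelve. all: by end_near. Qed.

Lemma smooth_flat n : smooth setT (flat n : R^o -> R^o).
Proof.
move=> k; elim: k n => [|k IH] n.
  move=> t _; apply: differentiable_continuous; apply/derivable1_diffP.
  by have [] := is_derive_flat n t.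
have df t : differentiable (flat n : R^o -> R^o) t.
  by apply/derivable1_diffP; have [] := is_derive_flat n t.
split=> [t _|v]; first exact: df.
apply: (@Ck_eq _ _ _ _ _
  (fun t => v *: (((- n%:R) : R^o) *: (flat n.+1 t : R^o) + flat n.+2 t)) _
    openT).
  move=> t _; rewrite [in RHS]deriveE// -[in RHS](mulr1 v) [RHS]linearZ/=
    -deriveE//.
  by have [_ ->] := is_derive_flat n t.
apply: CkZ; [exact: openT|exact: Ck_cst|].
by apply: CkD; [exact: openT|apply: CkZ; [exact: openT|exact: Ck_cst|]|].
Qed.

(** A smooth function supported in a ball for the maximum norm: it is
    [exp(-1/(e^2 - |x - x0|^2))] with the Euclidean norm, whose square is smooth
    and which dominates the maximum norm. *)
Lemma smooth_bump n (x0 : 'rV[R]_n) (e : R) : 0 < e ->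
  exists2 f : 'rV[R]_n -> R^o, smooth setT f &
    f x0 != 0 /\ forall x, f x != 0 -> `|x - x0| < e.
Proof.
move=> e0.
pose q (x : 'rV[R]_n) : R^o := \sum_i (x - x0) 0 i *: ((x - x0) 0 i : R^o).
have Cq : smooth setT q.
  apply: smooth_sum => [|i]; first exact: openT.
  have H : smooth setT (fun x : 'rV[R]_n => (x - x0) 0 i : R^o).
    apply: smooth_entry; first exact: openT.
    by apply: smoothD; [exact: openT|exact: smooth_id|exact: smooth_cst].
  by apply: smoothZ => //; exact: openT.
exists (fun x => flat 0 (e ^+ 2 - q x) : R^o).
  apply: (@smooth_comp_scalar _ _ _ setT setT);
    [exact: openT|exact: openT|by []| |exact: smooth_flat].
  apply: smoothD; [exact: openT|exact: smooth_cst|].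
  apply: (@smooth_eq _ _ _ _ (fun x => (-1 : R^o) *: q x)).
  - exact: openT.
  - by move=> x _; rewrite scaleN1r.
  by apply: smoothZ => //; [exact: openT|exact: smooth_cst].
have q_ge0 x i : 0 <= (x - x0) 0 i *: ((x - x0) 0 i : R^o)
  by rewrite [_ *: _]mulrC sqr_ge0.
split.
  rewrite /flat (_ : q x0 = 0) ?subr0 ?exprn_gt0//.
    by rewrite expr0 mul1r gt_eqF ?expR_gt0.
  by rewrite /q big1// => i _; rewrite subrr mxE scale0r.
move=> x; rewrite /flat; case: ifPn; last by rewrite eqxx.
rewrite subr_gt0 => qe _.
rewrite [X in X < _]mx_normrE; apply: bigmax_lt => //= -[i j] _ /=.
rewrite ord1 -(ltr_pXn2r (_ : 0 < 2)%N) ?nnegrE ?normr_ge0 ?ltW//.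
apply: le_lt_trans qe; rewrite real_normK ?num_real//.
rewrite /q (bigD1 j)//= -[X in X <= _]addr0; apply: lerD.
  by rewrite expr2.
by apply: sumr_ge0 => k _; exact: q_ge0.
Qed.

End SmoothMatrices.

(** * Charts and the tangent bundle *)

Section ManifoldCharts.
Context {R : realType} (n : nat) (M : atlas R n).
Hypothesis mM : is_manifold M.
Implicit Types (i j k : chart M) (p q : pt M) (O : set (pt M)).

Lemma coords_coord i O p : O p -> dom i p -> coords i O (coord i p).
Proof. by move=> Op ip; exists p. Qed.

Lemma coordsP i O x : coords i O x <->
  [/\ O (param i x), dom i (param i x) & coord i (param i x) = x].
Proof.
split=> [[p [Op ip] <-]|[Ox ix <-]]; last by exists (param i x).
by rewrite coordK.
Qed.

Lemma coordsS i O O' : O `<=` O' -> coords i O `<=` coords i O'.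
Proof. by move=> OO' _ [p [Op ip] <-]; exists p; split=> //; exact: OO'. Qed.

Lemma coords_dom i O : coords i O `<=` coords i (dom i).
Proof. by move=> _ [p [Op ip] <-]; exists p. Qed.

Lemma coordsI i O O' : coords i (O `&` O') = coords i O `&` coords i O'.
Proof.
apply/seteqP; split=> [x Ix|x].
  by split; apply: coordsS Ix => p [].
by move=> [/coordsP[? ? ?] /coordsP[? _ _]]; apply/coordsP.
Qed.

Lemma carrier_dom i p : dom i p -> carrier M p.
Proof. by exists i. Qed.

Lemma open_in_dom i : open_in (dom i).
Proof. by split=> [p|j]; [exact: carrier_dom|exact: open_overlap]. Qed.

Lemma open_inI O O' : open_in O -> open_in O' -> open_in (O `&` O').
Proof.
move=> [OM oO] [_ oO']; split=> [p [/OM//]|i].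
by rewrite coordsI; exact: openI.
Qed.

Lemma open_coords i O : open_in O -> open (coords i O).
Proof. by case. Qed.

Lemma param_change i j O x : coords i (O `&` dom j) x ->
  param j (change i j x) = param i x.
Proof. by move=> /coordsP[[_ jx] _ _]; rewrite /change/= coordK. Qed.

Lemma smooth_changeS i j O : O `<=` dom j -> smooth (coords i O) (change i j).
Proof.
by move=> Oj; apply: smooth_sub (smooth_change mM i j); exact: coordsS.
Qed.

Lemma open_in_chart i O (U : set 'rV[R]_n) : open_in O -> open U ->
  open_in [set p | [/\ O p, dom i p & U (coord i p)]].
Proof.
move=> oO oU; split=> [p [_ + _]|j]; first exact: carrier_dom.
have oOi := open_inI oO (open_in_dom i).
have := open_preimage (@open_coords j _ oOi) oU
  (@smooth_changeS j i (O `&` dom i) _).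
rewrite (_ : [set _ | _] = coords j
  [set p | [/\ O p, dom i p & U (coord i p)]]).
  by apply=> p [].
apply/seteqP; split=>
  [x [/coordsP[[Ox ix] jx xE] Ux]|x /coordsP[[Ox ix Ux] jx xE]].
  by apply/coordsP; split.
by split=> //; apply/coordsP.
Qed.

(** On an open subset of the domain of [i] smoothness can be checked in the
    chart [i] alone, by composition with the changes of charts. *)
Lemma smooth_from_chart (W : normedModType R) i O (f : pt M -> W) :
  open_in O -> O `<=` dom i -> smooth (coords i O) (f \o param i) ->
  forall j, smooth (coords j O) (f \o param j).
Proof.
move=> oO Oi Cf j.
have E : O `&` dom i = O by apply: setIidl.
have C : smooth (coords j O) (fun x => (f \o param i) (change j i x)).
  apply: smooth_comp Cf;
    [exact: open_coords|exact: open_coords| |exact: smooth_changeS].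
  move=> x /coordsP[Ox jx xE]; rewrite /change/=; apply: coords_coord => //.
  exact: Oi.
apply: smooth_eq C; first exact: open_coords.
by move=> x; rewrite -[in coords _ _]E => xO /=; rewrite (param_change xO).
Qed.

Lemma derive_change i j p (v : 'rV[R]_n) : dom i p -> dom j p ->
  v *m tangent_bundle M i j p = 'D_v (change i j) (coord i p).
Proof.
move=> ip jp; rewrite /tangent_bundle deriveEjacobian//.
by apply: smooth_differentiable (smooth_change mM i j) _; exact: coords_coord.
Qed.

Lemma near_coords i O p : open_in O -> O p -> dom i p ->
  \forall x \near coord i p, coords i O x.
Proof.
by move=> oO Op ip; apply: open_nbhs_nbhs; split;
  [exact: open_coords|exact: coords_coord].
Qed.

Lemma coord_change i j p : dom i p -> change i j (coord i p) = coord j p.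
Proof. by move=> ip; rewrite /change/= coordK. Qed.

(** The chain rule for a change of chart, on functions: the derivative along a
    tangent vector does not depend on the chart. *)
Lemma derive_chart (W : normedModType R) i j O (f : pt M -> W) p v :
  open_in O ->
  O p -> dom i p -> dom j p -> smooth (coords j O) (f \o param j) ->
  'D_v (f \o param i) (coord i p) =
  'D_(v *m tangent_bundle M i j p) (f \o param j) (coord j p).
Proof.
move=> oO Op ip jp Cf.
have oOj := open_inI oO (open_in_dom j).
transitivity ('D_v ((f \o param j) \o change i j) (coord i p)).
  apply: near_eq_derive; near=> x.
  have xO : coords i (O `&` dom j) x by near: x; exact: near_coords.
  by rewrite /= (param_change xO).
rewrite derive_comp; last 2 first.
- by apply: smooth_differentiable (smooth_change mM i j) _; exact: coords_coord.
- rewrite coord_change//; apply: smooth_differentiable Cf _;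
  exact: coords_coord.
by rewrite -derive_change// coord_change.
Unshelve. all: by end_near. Qed.

(** The cocycle condition is the chain rule for composed changes of charts. *)
Lemma tangent_vector_bundle : is_vector_bundle (tangent_bundle M).
Proof.
split.
- move=> i p ip; apply: eq_mulmx_row => v; rewrite mulmx1 derive_change//.
  rewrite -[RHS](derive_id (coord i p)); apply: near_eq_derive; near=> x.
  have : coords i (dom i) x by near: x; apply: near_coords => //;
    exact: open_in_dom.
  by move=> /coordsP[].
- move=> i j k p ip jp kp; apply: eq_mulmx_row => v; rewrite mulmxA.
  rewrite [RHS]derive_change// [LHS]derive_change//.
  rewrite /change (@derive_chart _ i j (dom k) (coord k))//;
    first exact: open_in_dom.
  exact: smooth_change.
move=> i j; have oU : open (coords i (dom j)) by exact: open_overlap.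
apply: smooth_mx => // u a.
apply: (@smooth_eq _ _ _ _
  (fun x => ('D_(rv_basis u) (change i j) x) 0 a : R^o)) => //.
  move=> x /coordsP[jx ix xE] /=.
  rewrite -[in LHS]xE -derive_change// /rv_basis -rowE mxE.
  by [].
by apply: smooth_entry => //; apply: smooth_derive; exact: smooth_change.
Unshelve. all: by end_near. Qed.

End ManifoldCharts.

(** * The total space of a vector bundle is a manifold *)

Section TotalSpace.
Context {R : realType} (n r : nat) (M : atlas R n) (A : bundle M r).
Hypothesis mM : is_manifold M.
Hypothesis vA : is_vector_bundle A.
Implicit Types (i j k : chart M) (p q : pt M) (O : set (pt M)).

(** The preimage of [O] in the total space; [tangent_over] is the case of the
    tangent bundle. *)
Definition bundle_over O : set (pt (total A)) :=
  [set e | O e.1 /\ fibre A e.1 e.2].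

(** The element of the fibre with components [v] in the chart [i]. *)
Definition vector_in i p (v : 'rV[R]_r) : components M r :=
  fun j => if `[< dom j p >] then v *m A i j p else 0.

Lemma vector_in_fibre i p v : dom i p -> fibre A p (vector_in i p v).
Proof.
move=> ip; split=> [j k jp kp|j jp]; rewrite /vector_in.
  by rewrite !asboolT// -mulmxA (bundle_comp vA).
by rewrite asboolF.
Qed.

Lemma vector_inE i p v : dom i p -> vector_in i p v i = v.
Proof. by move=> ip; rewrite /vector_in asboolT// (bundle_id vA)// mulmx1. Qed.

Lemma fibre_eq i p xi eta : dom i p -> fibre A p xi -> fibre A p eta ->
  xi i = eta i -> xi = eta.
Proof.
move=> ip [xiE xi0] [etaE eta0] E; apply/funext => j.
have [jp|jp] := pselect (dom j p); last by rewrite xi0// eta0.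
by rewrite (xiE i j)// (etaE i j)// E.
Qed.

Lemma vector_in_eq i p xi :
  dom i p -> fibre A p xi -> vector_in i p (xi i) = xi.
Proof.
move=> ip xiA; apply: (fibre_eq ip) => //; first exact: vector_in_fibre.
exact: vector_inE.
Qed.

Lemma total_coordsP i O z : coords (M := total A) i (bundle_over O) z <->
  coords i O (lsubmx z).
Proof.
split=> [[[p xi] [[/= Op _] [/= ip _] <-]]|/(coordsP mM)[Oz iz zE]].
  by rewrite row_mxKl; exact: coords_coord.
exists (param (a := total A) i z).
  by split; split=> //; exact: vector_in_fibre.
by rewrite /= zE asboolT// (bundle_id vA)// mulmx1 hsubmxK.
Qed.

Lemma total_coordK i (e : pt (total A)) : dom (a := total A) i e ->
  param (a := total A) i (coord (a := total A) i e) = e.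
Proof.
move=> [ip eA] /=; rewrite row_mxKl row_mxKr coordK//.
rewrite [X in (_, X)](_ : _ = e.2); first by case: (e).
exact: vector_in_eq.
Qed.

Lemma total_over_dom O :
  O `<=` carrier M -> bundle_over O `<=` carrier (total A).
Proof. by move=> OM [p xi] [/= /OM[i _ ip] xiA]; exists i. Qed.

Lemma total_coordsE i O : coords (M := total A) i (bundle_over O) =
  [set z | setT z /\ coords i O (lsubmx z)].
Proof.
by apply/seteqP; split=> z;
  [move/total_coordsP|move=> [_ ?]; apply/total_coordsP].
Qed.

Lemma open_in_bundle_over O : open_in O -> open_in (bundle_over O).
Proof.
move=> [OM oO]; split=> [|i]; first exact: total_over_dom.
rewrite total_coordsE.
apply: (open_preimage (f := fun z : 'rV[R]_(n + r) => lsubmx z)) => //;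
  first exact: openT.
by apply: smooth_lsubmx_id; exact: openT.
Qed.

Lemma smooth_base (W : normedModType R) i O (f : 'rV[R]_n -> W) : open_in O ->
  smooth (coords i O) f ->
  smooth (coords (M := total A) i (bundle_over O))
    (fun z : 'rV[R]_(n + r) => f (lsubmx z)).
Proof.
move=> oO Cf; have oT : open (coords (M := total A) i (bundle_over O)).
  exact/open_coords/open_in_bundle_over.
apply: (smooth_comp (O := coords i O)) => //; first exact: open_coords.
  by move=> z /total_coordsP.
exact: smooth_lsubmx_id.
Qed.

Lemma total_changeE i j (z : 'rV[R]_(n + r)) : coords i (dom j) (lsubmx z) ->
  change (M := total A) i j z =
  row_mx (change i j (lsubmx z)) (rsubmx z *m A i j (param i (lsubmx z))).
Proof. by move=> /(coordsP mM)[jz iz zE]; rewrite /change/= asboolT. Qed.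

Lemma total_open_overlap i j :
  open (coords (M := total A) i (dom (a := total A) j)).
Proof. exact/open_coords/open_in_bundle_over/open_in_dom. Qed.

Lemma total_smooth_change i j :
  smooth (coords (M := total A) i (dom (a := total A) j))
    (change (M := total A) i j).
Proof.
have oD := open_in_dom mM j.
have oT := @total_open_overlap i j.
apply: (@smooth_eq _ _ _ _ (fun z : 'rV[R]_(n + r) =>
  row_mx (change i j (lsubmx z)) (rsubmx z *m (A i j \o param i) (lsubmx z))))
    => //.
  by move=> z /total_coordsP zj; rewrite total_changeE.
apply: smooth_row_mx => //.
  by apply: smooth_base => //; exact: smooth_change.
apply: smooth_mulmx => //; first exact: smooth_rsubmx_id.
by apply: (smooth_base (f := A i j \o param i)) => //;
  exact: (bundle_smooth vA).
Qed.

Lemma total_coord_change i j (e : pt (total A)) : dom (a := total A) i e ->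
  change (M := total A) i j (coord (a := total A) i e) = coord (a := total A) j
    e.
Proof.
move=> ie.
by rewrite -[LHS]/(coord (a := total A) j
  (param (a := total A) i (coord (a := total A) i e))) total_coordK.
Qed.

(** The topology of the total space is generated by the charts; used to separate
    two vectors of the same fibre. *)
Lemma total_open_chart i (U : set 'rV[R]_(n + r)) : open U ->
  open_in (M := total A)
    [set e | dom (a := total A) i e /\ U (coord (a := total A) i e)].
Proof.
move=> oU; split=> [e [+ _]|j]; first by exists i.
have := open_preimage (@total_open_overlap j i) oU (@total_smooth_change j i).
rewrite (_ : [set _ | _] = coords (M := total A) j
  [set e | dom (a := total A) i e /\ U (coord (a := total A) i e)])//.
apply/seteqP; split=> [z [[e [ie je] <-]]|_ [e [[ie Ue] je] <-]].
  by rewrite total_coord_change// => Ue; exists e.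
split; first by exists e.
by rewrite total_coord_change.
Qed.

(** Points with distinct projections are separated by the preimages of open sets
    of [M], and vectors of one fibre by their components in one chart. *)
Lemma total_manifold : is_manifold (total A).
Proof.
split.
- exact: total_coordK.
- exact: total_open_overlap.
- exact: total_smooth_change.
- move=> [p xi] [q eta] [i _ [/= ip xiA]] [j _ [/= jq etaA]] neq.
  have [pq|pq] := pselect (p = q); last first.
    have [Q [Q' [oQ oQ' Qp Q'q QQ']]] :=
      manifold_hausdorff mM (carrier_dom ip) (carrier_dom jq) pq.
    exists (bundle_over Q), (bundle_over Q').
    split; [exact: open_in_bundle_over|exact: open_in_bundle_over|by []|by []|].
    by rewrite -subset0 => e [[Qe _] [Q'e _]]; have : (Q `&` Q') e.1 by [];
      rewrite QQ'.
  rewrite -{q}pq in jq etaA neq *.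
  have neqi : coord (a := total A) i (p, xi) != coord (a := total A) i (p, eta).
    apply/eqP => /= /eq_row_mx[_ E]; apply: neq; congr (_, _).
    exact: (fibre_eq ip xiA etaA E).
  have := @norm_hausdorff _ 'rV[R]_(n + r); rewrite open_hausdorff.
  move=> /(_ _ _ neqi)[[U U'] /= [/set_mem pU /set_mem qU'] [oU oU' /eqP UU']].
  exists [set e | dom (a := total A) i e /\ U (coord (a := total A) i e)].
  exists [set e | dom (a := total A) i e /\ U' (coord (a := total A) i e)].
  split=> //; [exact: total_open_chart|exact: total_open_chart|].
  by rewrite -subset0 => e [[_ Ue] [_ U'e]];
    have : (U `&` U') (coord (a := total A) i e) by []; rewrite UU'.
have [C cC CE] := manifold_second_countable mM.
exists C => //; apply/seteqP; split=> [[p xi] [i _ [/= ip xiA]]|e [i Ci ie]].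
  have [k Ck kp] : (\bigcup_(k in C) dom k) p by rewrite -CE; exists i.
  by exists k.
by exists i.
Qed.

End TotalSpace.

(** * Functions that are constant in one direction *)

Section Directional.
Context {R : realType}.
Implicit Types V W : normedModType R.

Lemma derive_shift_arg V W (f : V -> W) (c w x : V) :
  'D_w (f \o shift c) x = 'D_w f (x + c).
Proof.
rewrite /derive; set F := (X in lim (X @ _)); set G := (X in _ = lim (X @ _)).
by suff -> : F = G by []; apply/funext => h; rewrite /F /G /= addrA.
Qed.

(** A directional derivative depends only on the values along a line, so it can
    be computed from any other function with the same values. *)
Lemma derive_eq_line V V' W (f : V -> W) (g : V' -> W) e x e' x' :
  (forall h : R, f (h *: e + x) = g (h *: e' + x')) ->
  'D_e f x = 'D_e' g x'.
Proof.
move=> fg; have fgx : f x = g x' by have := fg 0; rewrite !scale0r !add0r.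
rewrite /derive; set F := (X in lim (X @ _)); set G := (X in _ = lim (X @ _)).
by suff -> : F = G by []; apply/funext => h; rewrite /F /G /= fg fgx.
Qed.

Lemma is_derive_line V (f : V -> R^o) (e y : V) (s : R) :
  differentiable f (s *: e + y) ->
  is_derive (s : R) 1 (fun t : R => f (t *: e + y) : R) ('D_e f (s *: e + y)).
Proof.
move=> df.
have dl : differentiable (fun t : R^o => t *: e + y) s.
  by apply: differentiableD;
    [exact: differentiableZl|exact: differentiable_cst].
have dc : differentiable (f \o (fun t : R^o => t *: e + y)) s.
  exact: differentiable_comp.
apply: DeriveDef; first exact/diff_derivable.
rewrite [LHS](derive_comp _ dl df); congr ('D_ _ f _).
rewrite [LHS]deriveD; last 2 first.
- exact/diff_derivable/differentiableZl.
- exact: derivable_cst.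
rewrite derive_cst addr0 [LHS](derive_scale (f := id) (g := cst e))//.
by rewrite derive_cst scaler0 add0r derive_id scale1r.
Qed.

Lemma derive0_line V (f : V -> R^o) (e y : V) (t : R) :
  (forall s : R, `|s| <= `|t| -> differentiable f (s *: e + y)) ->
  (forall s : R, `|s| <= `|t| -> 'D_e f (s *: e + y) = 0) ->
  f (t *: e + y) = f y.
Proof.
move=> df Df; pose g (s : R) : R := f (s *: e + y).
have H (s : R) : `|s| <= `|t| -> is_derive s 1 g 0.
  by move=> st; rewrite -(Df s st); exact/is_derive_line/df.
have gE (a b : R) : a <= b -> `|a| <= `|t| -> `|b| <= `|t| -> g a = g b.
  move=> ab at_ bt.
  have Hi s : s \in `[a, b] -> `|s| <= `|t|.
    rewrite in_itv/= => /andP[as_ sb]; rewrite ler_norml; apply/andP; split.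
      by apply: le_trans as_; move: at_; rewrite ler_norml => /andP[].
    by apply: le_trans sb _; move: bt; rewrite ler_norml => /andP[].
  have [c _ E] := @MVT_segment R g (fun=> 0) a b ab
    (fun s sI => H s (Hi s (subset_itv_oo_cc sI)))
    (@derivable_within_continuous _ _ g `[a, b]
      (fun s sI => @ex_derive _ _ _ _ _ _ _ (H s (Hi s sI)))).
  by move/eqP: E; rewrite mul0r subr_eq0 => /eqP.
have -> : f y = g 0 by rewrite /g scale0r add0r.
rewrite -/(g t); have [t0|t0] := leP 0 t.
  by apply/esym/gE; rewrite ?normr0.
by apply: gE; rewrite ?normr0// ltW.
Qed.

(** If [f] does not vary in the direction [e], neither does [D_w f]. This case
    of the symmetry of second derivatives follows from the mean value theorem:
    near [x] the function [f] is invariant under small translations along [e].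
    *)
Lemma derive_derive_eq0 V (U : set V) (f : V -> R^o) (e w x : V) :
  open U -> smooth U f -> (forall y, U y -> 'D_e f y = 0) -> U x ->
  'D_e (fun y => 'D_w f y) x = 0.
Proof.
move=> oU Cf De Ux.
have : nbhs x U by exact: open_nbhs_nbhs.
move=> /nbhs_ballP[eps /= eps0 epsU].
have cst_line (t : R) y : `|t| * `|e| < eps / 2 -> ball x (eps / 2) y ->
  f (t *: e + y) = f y.
  move=> te xy.
  have B (s : R) : `|s| <= `|t| -> U (s *: e + y).
    move=> st; apply: epsU; move: xy; rewrite -!ball_normE/= => xy.
    rewrite opprD addrCA addrC.
    rewrite (splitr eps) (le_lt_trans (ler_normB _ _))// ltr_leD//  normrZ.
    apply: le_trans (ltW te); exact: ler_wpM2r.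
  apply: derive0_line => s /B; first exact: smooth_differentiable.
  exact: De.
have e20 : 0 < eps / 2 by rewrite divr_gt0.
rewrite {1}/derive; apply: lim_near_cst => //.
near=> t.
have te : `|t| * `|e| < eps / 2.
  apply: (@le_lt_trans _ _ (`|t| * (`|e| + 1))); first by apply: ler_wpM2l;
    rewrite ?lerDl.
  rewrite -ltr_pdivlMr ?ltr_wpDl//.
  by near: t; apply: dnbhs0_lt; rewrite divr_gt0// ltr_wpDl.
suff E : 'D_w f (t *: e + x) = 'D_w f x by rewrite /= E subrr scaler0.
rewrite addrC -derive_shift_arg.
apply: near_eq_derive; near=> y; rewrite /= addrC; apply: cst_line => //.
near: y; exact: nbhsx_ballx.
Unshelve. all: by end_near. Qed.

End Directional.

(** * The bundle of TA over TM *)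

Section TangentLift.
Context {R : realType} (n r : nat) (M : atlas R n) (A : bundle M r).
Hypothesis mM : is_manifold M.
Hypothesis vA : is_vector_bundle A.
Implicit Types (i j k : chart M) (p q : pt M) (O : set (pt M)).

Local Notation TM := (tangent_manifold M).
Local Notation TA := (tangent_lift_bundle A).

Lemma tangent_manifold_is_manifold : is_manifold TM.
Proof. exact: total_manifold mM (tangent_vector_bundle mM). Qed.

Lemma bundle_smooth_chart i j k :
  smooth (coords k (dom i `&` dom j)) (A i j \o param k).
Proof.
apply: (smooth_from_chart mM (i := i)); last 2 first.
- by move=> p [].
- by apply: smooth_sub (bundle_smooth vA i j); apply: coordsS => p [].
by apply: open_inI => //; exact: open_in_dom.
Qed.

Lemma tangent_param_vector i (z : 'rV[R]_(n + n)) :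
  coords i (dom i) (lsubmx z) ->
  (param (a := TM) i z).2 i = rsubmx z.
Proof.
move=> /(coordsP mM)[ip _ _] /=.
by rewrite asboolT// (bundle_id (tangent_vector_bundle mM))// mulmx1.
Qed.

Lemma tangent_lift_bundle_param i j (z : 'rV[R]_(n + n)) :
  coords i (dom j) (lsubmx z) ->
  TA i j (param (a := TM) i z) =
  block_mx ((A i j \o param i) (lsubmx z))
           ('D_(rsubmx z) (A i j \o param i) (lsubmx z))
           0 ((A i j \o param i) (lsubmx z)).
Proof.
move=> zj; rewrite /tangent_lift_bundle tangent_param_vector;
  last exact: coords_dom zj.
have E : (param (a := TM) i z).1 = param i (lsubmx z) by [].
by have /(coordsP mM)[_ _ zE] := zj; rewrite E zE.
Qed.

(** The cocycle condition for the off-diagonal block is the product rule applied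
    to the cocycle condition of [A]. *)
Lemma tangent_lift_vector_bundle : is_vector_bundle TA.
Proof.
split; rewrite [chart _]/(chart M).
- move=> i [p v] [/= ip vT]; rewrite /tangent_lift_bundle/= (bundle_id vA)//.
  rewrite (_ : 'D__ _ _ = 0) -?scalar_mx_block//.
  rewrite -[RHS](derive_cst (1%:M : 'M[R]_r) (coord i p) (v i)).
  apply: near_eq_derive; near=> x.
  have : coords i (dom i) x by near: x; apply: near_coords => //;
    exact: open_in_dom.
  by move=> /(coordsP mM)[ix _ _]; rewrite /= (bundle_id vA).
- move=> i j k [p v] [/= ip vT] [/= jp _] [/= kp _].
  rewrite /tangent_lift_bundle/= mulmx_block !mulmx0 !mul0mx !addr0 add0r.
  rewrite (bundle_comp vA)//; congr (block_mx _ _ _ _).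
  have oD : open_in (dom j `&` dom k) by apply: open_inI => //;
    exact: open_in_dom.
  have -> : v j = v i *m tangent_bundle M i j p by have [/(_ i j ip jp)] := vT.
  rewrite -(derive_chart mM _ oD)//; last exact: bundle_smooth_chart.
  transitivity ('D_(v i) (fun x => (A i j \o param i) x *m (A j k \o param i) x)
    (coord i p)).
    rewrite derive_mulmx /= ?coordK// 1?addrC//.
      apply: smooth_differentiable (@bundle_smooth_chart i j i) _;
        exact: coords_coord.
    apply: smooth_differentiable (@bundle_smooth_chart j k i) _;
      exact: coords_coord.
  apply: near_eq_derive; near=> x.
  have : coords i (dom j `&` dom k) x by near: x; exact: near_coords.
  by move=> /(coordsP mM)[[jx kx] ix _]; rewrite /= (bundle_comp vA).
move=> i j; have oD : open_in (dom j) by exact: open_in_dom.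
have oT : open (coords (M := TM) i (dom (a := TM) j)).
  exact: open_overlap tangent_manifold_is_manifold _ _.
have CA : smooth (coords i (dom j)) (A i j \o param i)
  by exact: (bundle_smooth vA).
have zO (z : 'rV[R]_(n + n)) :
    coords (M := TM) i (dom (a := TM) j) z -> coords i (dom j) (lsubmx z).
  by move=> /(total_coordsP mM (tangent_vector_bundle mM)).
apply: (smooth_eq oT (fun z Hz => esym (tangent_lift_bundle_param (zO z Hz)))).
apply: smooth_block_mx; [exact: oT| | | |].
- exact: (smooth_base mM (tangent_vector_bundle mM) oD CA).
- apply: (smooth_derive_along oT (open_coords oD)) => //;
  [exact: zO|exact: smooth_lsubmx_id|exact: smooth_rsubmx_id].
- exact: smooth_cst.
- exact: (smooth_base mM (tangent_vector_bundle mM) oD CA).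
Unshelve. all: by end_near. Qed.

End TangentLift.

(** * The foliation of TM *)

Section TangentEntries.
Context {R : realType} (n : nat) (M : atlas R n).
Hypothesis mM : is_manifold M.
Implicit Types (i j : chart M) (p : pt M).

Lemma tangent_bundleE i j p u a : dom i p -> dom j p ->
  tangent_bundle M i j p u a =
  'D_(delta_mx 0 u) (fun x => change i j x 0 a : R^o) (coord i p).
Proof.
move=> ip jp; transitivity
  (((delta_mx 0 u : 'rV[R]_n) *m tangent_bundle M i j p) 0 a).
  by rewrite -rowE [in RHS]mxE.
rewrite derive_change// derive_entry//.
by apply: smooth_differentiable (smooth_change mM i j) _; exact: coords_coord.
Qed.

End TangentEntries.

Section FoliatedTangent.
Context {R : realType} (n : nat) (M : atlas R n) (tr : {set 'I_n}).
Hypothesis fM : is_foliated_manifold M tr.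
Let mM : is_manifold M := foliated_is_manifold fM.
Let vT : is_vector_bundle (tangent_bundle M) := tangent_vector_bundle mM.
Implicit Types (i j k : chart M) (p q : pt M) (O : set (pt M)).
Local Notation TM := (tangent_manifold M).

Lemma tangent_foliation_lshift a :
  (lshift n a \in tangent_foliation tr) = (a \in tr).
Proof. by rewrite /tangent_foliation inE split_lshift. Qed.

Lemma tangent_foliation_rshift a :
  (rshift n a \in tangent_foliation tr) = (a \in tr).
Proof. by rewrite /tangent_foliation inE split_rshift. Qed.

Lemma lsubmx_lshift_delta (u : 'I_n) :
  lsubmx (delta_mx 0 (lshift n u) : 'rV[R]_(n + n)) = delta_mx 0 u.
Proof. by apply/rowP => b; rewrite !mxE eq_lshift. Qed.
Lemma rsubmx_lshift_delta (u : 'I_n) :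
  rsubmx (delta_mx 0 (lshift n u) : 'rV[R]_(n + n)) = 0.
Proof. by apply/rowP => b; rewrite !mxE eq_rlshift. Qed.
Lemma lsubmx_rshift_delta (u : 'I_n) :
  lsubmx (delta_mx 0 (rshift n u) : 'rV[R]_(n + n)) = 0.
Proof. by apply/rowP => b; rewrite !mxE eq_lrshift. Qed.
Lemma rsubmx_rshift_delta (u : 'I_n) :
  rsubmx (delta_mx 0 (rshift n u) : 'rV[R]_(n + n)) = delta_mx 0 u.
Proof. by apply/rowP => b; rewrite !mxE eq_rshift. Qed.

(** A transverse coordinate of a change of chart is constant along the leaves,
    and so are its first derivatives. *)
Lemma transverse_derive_leafwise i j p u a w :
  dom i p -> dom j p -> u \notin tr -> a \in tr ->
  'D_(delta_mx 0 u) (fun x => 'D_w (fun x => change i j x 0 a : R^o) x)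
    (coord i p) = 0.
Proof.
move=> ip jp ut at_.
apply: (derive_derive_eq0 (U := coords i (dom j))).
- exact: open_overlap.
- by apply: smooth_entry; [exact: open_overlap|exact: smooth_change].
- move=> y /(coordsP mM)[jy iy <-].
  by rewrite -(tangent_bundleE mM)//; exact: (foliated_change fM).
- exact: coords_coord.
Qed.

(** A change of chart of TM is [(x, v) |-> (c x, D_v c x)]. Its transverse
    coordinates are [c_a] and [D_v c_a] with [a] transverse: they are constant
    in a leafwise [x_u] by [transverse_derive_leafwise], and in a leafwise [v_u]
    because [D_v c_a] changes by a multiple of [D_u c_a = 0]. *)
Lemma tangent_foliated_change i j (pv : pt TM) u a :
  dom (a := TM) i pv -> dom (a := TM) j pv ->
  u \notin tangent_foliation tr -> a \in tangent_foliation tr ->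
  tangent_bundle TM i j pv u a = 0.
Proof.
move: pv => [p v] iv jv; have [/= ip vp] := iv; have [/= jp _] := jv.
have mT : is_manifold TM by exact: total_manifold.
rewrite (tangent_bundleE mT)//.
pose f b x : R^o := change i j x 0 b.
have Dch z b w : coords i (dom j) z -> differentiable (f b) z /\
  (w *m tangent_bundle M i j (param i z)) 0 b = 'D_w (f b) z.
  move=> /(coordsP mM)[jz iz zE].
  have dch : differentiable (change i j) z.
    apply: smooth_differentiable (smooth_change mM i j) _; rewrite -zE.
    exact: coords_coord.
  split.
    exact: (differentiable_comp dch (differentiable_coord _ _ _)).
  by rewrite derive_change// zE derive_entry.
have xj : coords i (dom j) (coord i p) by exact: coords_coord.
have zj : \forall z \near (coord (a := TM) i (p, v) : 'rV[R]_(n + n)),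
  coords i (dom j) (lsubmx z).
  near=> z; suff : coords (M := TM) i (dom (a := TM) j) z.
    by move=> /(total_coordsP mM vT).
  near: z; apply: near_coords => //; exact: (open_in_dom mT).
pose x := coord i p; pose w := v i.
have zE : coord (a := TM) i (p, v) = row_mx x w by [].
have lE (h : R) (e : 'rV[R]_(n + n)) : lsubmx (h *: e + row_mx x w) = h *:
  lsubmx e + x.
  by rewrite linearP/= row_mxKl.
have rE (h : R) (e : 'rV[R]_(n + n)) : rsubmx (h *: e + row_mx x w) = h *:
  rsubmx e + w.
  by rewrite linearP/= row_mxKr.
have Z b : b \in tr -> forall u0, u0 \notin tr ->
  'D_(delta_mx 0 u0) (f b) x = 0.
  by move=> bt u0 ut; rewrite -(tangent_bundleE mM)//;
    exact: (foliated_change fM).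
case: (split_ordP a) => b ->;
  rewrite ?tangent_foliation_lshift ?tangent_foliation_rshift => ut bt.
  transitivity ('D_(delta_mx 0 u) (fun z : 'rV[R]_(n + n) => f b (lsubmx z))
    (row_mx x w)).
    apply: near_eq_derive; near=> z.
    rewrite (total_changeE _ mM)/=; last by near: z; exact: zj.
    by rewrite row_mxEl.
  transitivity ('D_(lsubmx (delta_mx 0 u)) (f b) x).
    by apply: derive_eq_line => h; rewrite lE.
  case: (split_ordP u) ut => u0 ->;
    rewrite ?tangent_foliation_lshift ?tangent_foliation_rshift => ut.
    by rewrite lsubmx_lshift_delta; exact: Z.
  by rewrite lsubmx_rshift_delta derive0.
transitivity ('D_(delta_mx 0 u)
  (fun z : 'rV[R]_(n + n) => 'D_(rsubmx z) (f b) (lsubmx z)) (row_mx x w)).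
  apply: near_eq_derive; near=> z.
  have zj' : coords i (dom j) (lsubmx z) by near: z; exact: zj.
  by rewrite (total_changeE _ mM)//= row_mxEr; have [_ ->] :=
    Dch _ b (rsubmx z) zj'.
case: (split_ordP u) ut => u0 ->;
  rewrite ?tangent_foliation_lshift ?tangent_foliation_rshift => ut.
  transitivity ('D_(delta_mx 0 u0) (fun x => 'D_w (f b) x) x).
    by apply: derive_eq_line => h;
      rewrite lE rE lsubmx_lshift_delta rsubmx_lshift_delta scaler0 add0r.
  exact: transverse_derive_leafwise.
have [df _] := Dch _ b 0 xj.
transitivity ('D_(delta_mx 0 u0 : 'rV[R]_n) (fun _ : 'rV[R]_n => 'D_w (f b) x)
  0); last exact: derive_cst.
apply: derive_eq_line => h;
  rewrite lE rE lsubmx_rshift_delta rsubmx_rshift_delta.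
rewrite scaler0 add0r !deriveE// linearP -[in X in X + _]deriveE//.
by rewrite Z// [X in X + _]mulr0 add0r.
Unshelve. all: by end_near. Qed.

Lemma tangent_foliated_manifold :
  is_foliated_manifold TM (tangent_foliation tr).
Proof.
split; first exact: tangent_manifold_is_manifold.
move=> i j pv iv jv u a; exact: tangent_foliated_change.
Qed.

End FoliatedTangent.

(** * Sections and their lifts *)

Section Sections.
Context {R : realType} (n r : nat) (M : atlas R n) (A : bundle M r).
Hypothesis mM : is_manifold M.
Hypothesis vA : is_vector_bundle A.
Implicit Types (i j : chart M) (p q : pt M) (O : set (pt M))
  (s t : pt M -> components M r).

Lemma section_sub O O' s : O' `<=` O -> section A O s -> section A O' s.
Proof.
move=> OO' [sA Cs]; split=> [p /OO'/sA//|i]; apply: smooth_sub (Cs i).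
exact: coordsS.
Qed.

Lemma fibreZD p (c : R) xi eta : fibre A p xi -> fibre A p eta ->
  fibre A p (c *: xi + eta).
Proof.
move=> [x1 x0] [e1 e0]; split=> [i j ip jp|i ip].
  by rewrite !fctE (x1 i j)// (e1 i j)// mulmxDl scalemxAl.
by rewrite !fctE x0// e0// scaler0 addr0.
Qed.

Lemma fibre0 p : fibre A p 0.
Proof. by split=> // i j _ _; rewrite mul0mx. Qed.

Lemma fibreZ p (c : R) xi : fibre A p xi -> fibre A p (c *: xi).
Proof.
by move=> xiA; rewrite -[_ *: _]addr0; apply: fibreZD => //; exact: fibre0.
Qed.

Lemma fibreD p xi eta : fibre A p xi -> fibre A p eta -> fibre A p (xi + eta).
Proof. by move=> xA eA; rewrite -[xi]scale1r; exact: fibreZD. Qed.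

Lemma fibre_sum p (I : Type) (l : seq I) (e : I -> components M r) :
  (forall k, fibre A p (e k)) -> fibre A p (\sum_(k <- l) e k).
Proof. by move=> eA; elim/big_ind: _ => //; [exact: fibre0|exact: fibreD]. Qed.

Lemma section0 O : open_in O -> section A O 0.
Proof. by move=> oO; split=> [p _|i]; [exact: fibre0|exact: smooth_cst]. Qed.

Lemma sectionZ O s (f : pt M -> R^o) : open_in O ->
  section A O s -> smooth_fun O f -> section A O (fun q => f q *: s q).
Proof.
move=> oO [sA Cs] Cf; split=> [p Op|i]; first exact/fibreZ/sA.
by apply: (smoothZ (open_coords oO)); [exact: Cf|exact: Cs].
Qed.

Lemma sectionD O s t : open_in O ->
  section A O s -> section A O t -> section A O (fun q => s q + t q).
Proof.
move=> oO [sA Cs] [tA Ct]; split=> [p Op|i].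
  by apply: fibreD; [exact: sA|exact: tA].
by apply: (smoothD (open_coords oO)); [exact: Cs|exact: Ct].
Qed.

Lemma section_sum O (I : Type) (l : seq I) (e : I -> pt M -> components M r) :
  open_in O ->
  (forall k, section A O (e k)) -> section A O (fun q => \sum_(k <- l) e k q).
Proof.
move=> oO Ce; elim: l => [|k l IH].
  rewrite (_ : (fun q => _) = 0); first exact: section0.
  by apply/funext => q; rewrite big_nil.
rewrite (_ : (fun q => _) = fun q => e k q + \sum_(k <- l) e k q);
  first exact: sectionD.
by apply/funext => q; rewrite big_cons.
Qed.

Lemma smooth_funS O O' (f : pt M -> R^o) :
  O' `<=` O -> smooth_fun O f -> smooth_fun O' f.
Proof. by move=> OO' Cf i; apply: smooth_sub (Cf i); exact: coordsS. Qed.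

Lemma smooth_fun_cst O (c : R) : smooth_fun O (fun=> c).
Proof. by move=> i; exact: smooth_cst. Qed.

Lemma section_from_chart i O s : open_in O -> O `<=` dom i ->
  (forall p, O p -> fibre A p (s p)) ->
  smooth (coords i O) (fun x => s (param i x) i) -> section A O s.
Proof.
move=> oO Oi sA Cs; split=> // j.
apply: (@smooth_eq _ _ _ _ (fun x => s (param j x) i *m (A i j \o param j) x)).
- exact: open_coords.
- move=> x /(coordsP mM)[Ox jx _] /=.
  by have [/(_ i j (Oi _ Ox) jx)] := sA _ Ox.
apply: smooth_mulmx; first exact: open_coords.
  exact: (smooth_from_chart mM (f := fun q => s q i) oO Oi).
apply: (smooth_sub _ (bundle_smooth_chart mM vA i j j)).
move=> x /(coordsP mM)[Ox jx xE]; apply/(coordsP mM); split=> //.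
by split=> //; exact: Oi.
Qed.

Definition constant_frame i (v : 'rV[R]_r) p : components M r :=
  vector_in A i p v.

Lemma constant_frame_section i v : section A (dom i) (constant_frame i v).
Proof.
apply: section_from_chart (@subset_refl _ _) _ _; first exact: open_in_dom.
  by move=> p ip; exact: vector_in_fibre.
have oD : open (coords i (dom i)) by apply/open_coords/open_in_dom.
apply: (@smooth_eq _ _ _ _ (fun=> v)) => //; last exact: smooth_cst.
by move=> x /(coordsP mM)[ix _ _]; rewrite /constant_frame vector_inE.
Qed.

End Sections.

Section Lifts.
Context {R : realType} (n r : nat) (M : atlas R n) (A : bundle M r).
Hypothesis mM : is_manifold M.
Hypothesis vA : is_vector_bundle A.
Implicit Types (i j : chart M) (p q : pt M) (O : set (pt M))
  (s t : pt M -> components M r).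
Local Notation TM := (tangent_manifold M).
Local Notation TA := (tangent_lift_bundle A).
Let vT : is_vector_bundle (tangent_bundle M) := tangent_vector_bundle mM.

Definition local_rep s i (x : 'rV[R]_n) : 'rV[R]_r := s (param i x) i.

Lemma complete_liftE s i (pv : pt TM) : dom i pv.1 ->
  complete_lift s pv i =
  row_mx (s pv.1 i) ('D_(pv.2 i) (local_rep s i) (coord i pv.1)).
Proof. by move=> ip; rewrite /complete_lift asboolT. Qed.

Lemma vertical_liftE s i (pv : pt TM) : dom i pv.1 ->
  vertical_lift s pv i = row_mx 0 (s pv.1 i).
Proof. by move=> ip; rewrite /vertical_lift asboolT. Qed.

Lemma open_in_tangent_over O : open_in O -> open_in (M := TM) (tangent_over O).
Proof. exact: (open_in_bundle_over mM vT). Qed.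

Lemma local_rep_differentiable O s i p : section A O s -> O p -> dom i p ->
  differentiable (local_rep s i) (coord i p).
Proof.
move=> [_ /(_ i) Cs] Op ip; apply: smooth_differentiable Cs _.
exact: coords_coord.
Qed.

(** The components of [s^C] transform by the derivative of the relation [s_j =
    s_i *m A i j] along the tangent vector. *)
Lemma complete_lift_fibre O s (pv : pt TM) : open_in O -> section A O s ->
  tangent_over O pv -> fibre TA pv (complete_lift s pv).
Proof.
move: pv => [p v] oO sS [/= Op vp]; have [sA Cs] := sS.
have [sp _] := sA _ Op.
split; rewrite [chart _]/(chart M);
  [move=> i j [/= ip _] [/= jp _]|move=> i iN]; last first.
  by rewrite /complete_lift asboolF//= => ip; apply: iN.
rewrite !complete_liftE//= /tangent_lift_bundle mul_row_block mulmx0 addr0 /=.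
rewrite -(sp i j ip jp); congr row_mx.
have -> : v j = v i *m tangent_bundle M i j p by have [/(_ i j ip jp)] := vp.
rewrite -(derive_chart mM (f := fun q => s q j) _ oO Op ip jp (Cs j)).
have oOj := open_inI mM oO (open_in_dom mM j).
transitivity ('D_(v i) (fun x => local_rep s i x *m (A i j \o param i) x)
  (coord i p)).
  apply: near_eq_derive; near=> x.
  have : coords i (O `&` dom j) x by near: x; exact: near_coords.
  by move=> /(coordsP mM)[[Ox jx] ix _]; have [/(_ i j ix jx)] := sA _ Ox.
rewrite derive_mulmx; last 2 first.
- exact: local_rep_differentiable sS Op ip.
- apply: smooth_differentiable (bundle_smooth_chart mM vA i j i) _.
  exact: coords_coord.
by rewrite [(_ \o _) _]/= /local_rep coordK// addrC.
Unshelve. all: by end_near. Qed.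

Lemma vertical_lift_fibre O s (pv : pt TM) : section A O s ->
  tangent_over O pv -> fibre TA pv (vertical_lift s pv).
Proof.
move: pv => [p v] [sA Cs] [/= Op vp]; have [sp _] := sA _ Op.
split; rewrite [chart _]/(chart M);
  [move=> i j [/= ip _] [/= jp _]|move=> i iN]; last first.
  by rewrite /vertical_lift asboolF//= => ip; apply: iN.
by rewrite !vertical_liftE// /tangent_lift_bundle mul_row_block mulmx0 !mul0mx
  !add0r -(sp i j).
Qed.

Lemma tangent_coords_base i O (z : 'rV[R]_(n + n)) :
  coords (M := TM) i (tangent_over O) z -> coords i O (lsubmx z).
Proof. by move=> /(total_coordsP mM vT). Qed.

Lemma open_tangent_coords i O :
  open_in O -> open (coords (M := TM) i (tangent_over O)).
Proof. by move=> oO; apply: open_coords; exact: open_in_tangent_over. Qed.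

Lemma complete_lift_section O s : open_in O -> section A O s ->
  section TA (tangent_over O) (complete_lift s).
Proof.
move=> oO sS; split=> [pv|]; first exact: complete_lift_fibre.
rewrite [chart _]/(chart M) => i.
have oT := @open_tangent_coords i O oO; have [_ /(_ i) Cs] := sS.
apply: (smooth_eq oT (f := fun z : 'rV[R]_(n + n) =>
  row_mx (local_rep s i (lsubmx z))
    ('D_(rsubmx z) (local_rep s i) (lsubmx z)))).
  move=> z /tangent_coords_base zO; rewrite complete_liftE;
    last by have /(coordsP mM)[] := zO.
  rewrite tangent_param_vector; [|exact: mM|exact: coords_dom zO].
  have E : (param (a := TM) i z).1 = param i (lsubmx z) by [].
  by have /(coordsP mM)[_ _ zE] := zO; rewrite E zE.
apply: smooth_row_mx; first exact: oT.
  exact: (smooth_base mM vT oO Cs).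
apply: (smooth_derive_along oT (open_coords oO) (@tangent_coords_base i O) Cs).
  exact: smooth_lsubmx_id.
exact: smooth_rsubmx_id.
Qed.

Lemma vertical_lift_section O s : open_in O -> section A O s ->
  section TA (tangent_over O) (vertical_lift s).
Proof.
move=> oO sS; split=> [pv|]; first exact: vertical_lift_fibre.
rewrite [chart _]/(chart M) => i.
have oT := @open_tangent_coords i O oO; have [_ /(_ i) Cs] := sS.
apply: (smooth_eq oT (f := fun z : 'rV[R]_(n + n) =>
  row_mx 0 (local_rep s i (lsubmx z)))).
  by move=> z /tangent_coords_base zO; rewrite vertical_liftE;
    last by have /(coordsP mM)[] := zO.
apply: smooth_row_mx; first exact: oT.
  exact: smooth_cst.
exact: (smooth_base mM vT oO Cs).
Qed.

End Lifts.

(** * Local frames of a subbundle *)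

Section Frames.
Context {R : realType} (n r : nat) (M : atlas R n) (A : bundle M r).
Hypothesis mM : is_manifold M.
Hypothesis vA : is_vector_bundle A.
Implicit Types (i j : chart M) (p q : pt M) (O Q : set (pt M))
  (s t : pt M -> components M r) (B : pt M -> set (components M r)).

Definition local_frame m B O (b : 'I_m -> pt M -> components M r) : Prop :=
  [/\ open_in O, forall k, section A O (b k),
      forall q, O q ->
        B q = [set xi | exists c : 'I_m -> R, xi = \sum_k c k *: b k q] &
      forall q, O q -> forall c : 'I_m -> R,
        \sum_k c k *: b k q = 0 -> forall k, c k = 0].

Definition frame_mx m (b : 'I_m -> pt M -> components M r) i p : 'M[R]_(m, r) :=
  \matrix_(k, a) b k p i 0 a.

Lemma frame_mxE m (b : 'I_m -> pt M -> components M r) i p (c : 'I_m -> R) :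
  (\sum_k c k *: b k p) i = (\row_k c k) *m frame_mx b i p.
Proof.
rewrite fct_sumE mulmx_sum_row; apply: eq_bigr => k _.
by rewrite !mxE !fctE; congr (_ *: _); apply/rowP => a; rewrite !mxE.
Qed.

Lemma local_frame_linear m B O (b : 'I_m -> pt M -> components M r) q (c : R) xi
  eta :
  local_frame B O b -> O q -> B q xi -> B q eta -> B q (c *: xi + eta).
Proof.
move=> [_ _ BE _] Oq; rewrite BE// => -[x ->] [y ->].
exists (fun k => c * x k + y k); rewrite scaler_sumr -big_split/=.
by apply: eq_bigr => k _; rewrite scalerDl scalerA.
Qed.

Lemma local_frame0 m B O (b : 'I_m -> pt M -> components M r) q :
  local_frame B O b -> O q -> B q 0.
Proof.
move=> [_ _ BE _] Oq; rewrite BE//; exists (fun=> 0).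
by rewrite big1// => k _; rewrite scale0r.
Qed.

Lemma local_frame_mem m B O (b : 'I_m -> pt M -> components M r) q k :
  local_frame B O b -> O q -> B q (b k q).
Proof.
move=> [_ _ BE _] Oq; rewrite BE//; exists (fun l => (l == k)%:R).
rewrite (bigD1 k)//= eqxx scale1r big1 ?addr0// => l /negbTE ->.
by rewrite scale0r.
Qed.

Lemma local_frameS m B O O' (b : 'I_m -> pt M -> components M r) :
  open_in O' -> O' `<=` O -> local_frame B O b -> local_frame B O' b.
Proof.
move=> oO' OO' [oO bS BE bI]; split=> // [k|q /OO'|q /OO'].
- exact: section_sub (bS k).
- exact: BE.
- exact: bI.
Qed.

(** A smooth right inverse of the matrix of components: multiplying by it reads
    off the coefficients of a combination of the frame. *)
Definition coframe m O (b : 'I_m -> pt M -> components M r)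
    (H : chart M -> pt M -> 'M[R]_(r, m)) : Prop :=
  (forall i, smooth (coords i O) (H i \o param i)) /\
  (forall i q, O q -> dom i q -> frame_mx b i q *m H i q = 1%:M).

Lemma smooth_frame_mx m O (b : 'I_m -> pt M -> components M r) i : open_in O ->
  (forall k, section A O (b k)) ->
    smooth (coords i O) (frame_mx b i \o param i).
Proof.
move=> oO bS; have oC := open_coords (i := i) oO.
apply: smooth_mx => // k a.
apply: (smooth_eq oC (f := fun x => local_rep (b k) i x 0 a : R^o)).
  by move=> x _; rewrite mxE.
by apply: smooth_entry => //; case: (bS k) => _; exact.
Qed.

(** A right inverse found in one chart [i0] is carried to the others by the
    transition matrices of [A]. *)
Lemma coframe_exists m B O (b : 'I_m -> pt M -> components M r) p i0 :
  local_frame B O b -> O p -> dom i0 p ->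
  exists O' H, [/\ open_in O', O' p, O' `<=` O,
    O' `<=` dom i0 & coframe O' b H].
Proof.
move=> [oO bS BE bI] Op ip.
pose O1 := O `&` dom i0.
have oO1 : open_in O1 by apply: open_inI => //; exact: open_in_dom.
have Cb : smooth (coords i0 O1) (frame_mx b i0 \o param i0).
  apply: smooth_sub (smooth_frame_mx i0 oO bS); apply: coordsS => q; by case.
have x0 : coords i0 O1 (coord i0 p) by apply: coords_coord.
have free : row_free ((frame_mx b i0 \o param i0) (coord i0 p)).
  apply: inj_row_free => v; rewrite /= coordK// => vb.
  have E : \sum_k v 0 k *: b k p = 0.
    apply: (fibre_eq (A := A) ip _ (fibre0 A p)); last first.
      rewrite frame_mxE -[RHS]vb; congr (_ *m _).
      by apply/rowP => k; rewrite mxE.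
    have [+ _] := section_sum (index_enum _) oO
      (fun k => sectionZ oO (bS k) (smooth_fun_cst O (v 0 k))).
    exact.
  by apply/rowP => k; rewrite mxE; exact: bI E k.
have [U [G [oU Ux UO CG bG]]] :=
  smooth_right_inverse (open_coords oO1) x0 Cb free.
pose O' := [set q | [/\ O1 q, dom i0 q & U (coord i0 q)]].
have oO' : open_in O' by exact: open_in_chart.
have O'i : O' `<=` dom i0 by move=> q [].
exists O', (fun i q => A i i0 q *m G (coord i0 q)); split=> //.
  by move=> q [[]].
split=> [i|i q [[Oq _] i0q Uq] iq].
  have oC := open_coords (i := i) oO'.
  apply: (smooth_mulmx oC (f := A i i0 \o param i)
    (g := (G \o coord i0) \o param i)).
    apply: (smooth_sub _ (bundle_smooth vA i i0)).
    exact: coordsS.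
  apply: (smooth_from_chart mM oO' O'i).
  apply: (smooth_eq (open_coords oO') (f := G)).
    by move=> x /(coordsP mM)[_ _ xE]; rewrite /= xE.
  by apply: smooth_sub CG => x /(coordsP mM)[[_ _ +] _ xE]; rewrite xE.
rewrite mulmxA (_ : _ *m A i i0 q = frame_mx b i0 q).
  by have := bG _ Uq; rewrite /= coordK.
apply/row_matrixP => k; rewrite row_mul.
have E j : row k (frame_mx b j q) = b k q j by apply/rowP => a; rewrite !mxE.
by rewrite !E; have [/(_ _ Oq)[/(_ i i0 iq i0q)]] := bS k.
Qed.

Lemma coframe_coef m O (b : 'I_m -> pt M -> components M r) H i q
  (c : 'I_m -> R) k :
  coframe O b H -> O q -> dom i q ->
  ((\sum_k c k *: b k q) i *m H i q) 0 k = c k.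
Proof. by move=> [_ bH] Oq iq; rewrite frame_mxE -mulmxA bH// mulmx1 mxE. Qed.

(** The coefficients are the components of the section times the coframe. *)
Lemma smooth_coefficients m B O (b : 'I_m -> pt M -> components M r) p :
  local_frame B O b -> O p ->
  exists O', [/\ open_in O', O' p, O' `<=` O & forall Q s, open_in Q ->
    Q `<=` O' -> subsection A B Q s ->
    exists f : 'I_m -> pt M -> R^o, (forall k, smooth_fun Q (f k)) /\
      forall q, Q q -> s q = \sum_k f k q *: b k q].
Proof.
move=> bF Op; have [oO bS BE bI] := bF.
have [i0 _ ip] : carrier M p by have [+ _] := oO; apply.
have [P [H [oP Pp PO Pi Hb]]] := coframe_exists bF Op ip.
exists P; split=> // Q s oQ QP [[sA Cs] sB].
exists (fun k q => (s q i0 *m H i0 q) 0 k); split=> [k|q Qq].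
  have Qi : Q `<=` dom i0 by move=> q /QP/Pi.
  apply: (smooth_from_chart mM oQ Qi
    (f := fun q => (s q i0 *m H i0 q) 0 k : R^o)).
  have oC := open_coords (i := i0) oQ.
  suff C : smooth (coords i0 Q)
    (fun x => local_rep s i0 x *m (H i0 \o param i0) x).
    exact: (smooth_entry 0 k oC C).
  apply: (smooth_mulmx oC (Cs i0)).
  by have [/(_ i0) + _] := Hb; apply: smooth_sub; exact: coordsS.
have [c sE] : exists c : 'I_m -> R, s q = \sum_k c k *: b k q.
  by have := sB _ Qq; rewrite BE//; exact/PO/QP.
rewrite [in LHS]sE; apply: eq_bigr => k _; rewrite sE.
by rewrite (coframe_coef _ _ Hb)//; [exact: QP|exact/Pi/QP].
Qed.

End Frames.

(** * The subbundle TB of TA *)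

Section TangentSubbundle.
Context {R : realType} (n r : nat) (M : atlas R n) (A : bundle M r).
Hypothesis mM : is_manifold M.
Hypothesis vA : is_vector_bundle A.
Variable B : pt M -> set (components M r).
Implicit Types (i j : chart M) (p q : pt M) (O Q : set (pt M))
  (s t : pt M -> components M r).
Local Notation TM := (tangent_manifold M).
Local Notation TA := (tangent_lift_bundle A).
Local Notation TB := (tangent_subbundle A B).

(** The curve [tau |-> (x + tau v, (s + tau t)(x + tau v))] lies in [B], and its
    velocity at 0 has the components of [s^C + t^V]. *)
Lemma tangent_subbundle_curve O s t (pv : pt TM) : open_in O ->
  (forall q, O q -> forall (c : R) xi eta, B q xi -> B q eta ->
    B q (c *: xi + eta)) ->
  subsection A B O s -> subsection A B O t -> tangent_over O pv ->
  TB pv (complete_lift s pv + vertical_lift t pv).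
Proof.
move: pv => [p v] oO Blin [sS sB] [tS tB] pvO; have [/= Op vp] := pvO.
have [[sA Cs] [tA Ct]] := (sS, tS).
have [i _ ip] : carrier M p by have [+ _] := oO; apply.
set w := _ + _.
pose x := coord i p; pose v0 : 'rV[R]_n := v i.
pose S := local_rep s i; pose T := local_rep t i.
have wE : w i = row_mx (S x) ('D_v0 S x + T x).
  rewrite /w fctE complete_liftE// vertical_liftE// add_row_mx addr0/=.
  by rewrite /S /T /local_rep /x coordK.
pose l (tau : R^o) : 'rV[R]_n := tau *: v0 + x.
pose U : set R^o := [set tau | setT tau /\ coords i O (l tau)].
have Cl : smooth setT l.
  apply: smoothD; [exact: openT| |exact: smooth_cst].
  by apply: smoothZ; [exact: openT|exact: smooth_id|exact: smooth_cst].
have oC := open_coords (i := i) oO.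
have oU : open U by exact: open_preimage openT oC Cl.
have CU : smooth U l by apply: smooth_sub Cl.
have l0 : l 0 = x by rewrite /l scale0r add0r.
have U0 : U 0 by split=> //; rewrite l0; exact: coords_coord.
have lU tau : U tau -> coords i O (l tau) by case.
(* the curve in the chart [i], and as a map into the total space *)
pose gamma tau : 'rV[R]_(n + r) :=
  row_mx (l tau) (S (l tau) + tau *: T (l tau)).
pose c (tau : R^o) : pt (total A) :=
  (param i (l tau), s (param i (l tau)) + tau *: t (param i (l tau))).
have cE tau : U tau -> coord (a := total A) i (c tau) = gamma tau.
  by move=> [_ /(coordsP mM)[_ _ lE]]; rewrite /= lE.
have D0 : 'D_1 gamma 0 = row_mx v0 ('D_v0 S x + T x).
  have dl : differentiable l 0 by apply: smooth_differentiable Cl _.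
  have Dl : 'D_1 l 0 = v0.
    rewrite [LHS](deriveD (f := fun tau : R^o => tau *: v0)); last 2 first.
    - by apply/diff_derivable/differentiableZl.
    - exact: derivable_cst.
    rewrite derive_cst addr0 [LHS](derive_scale (f := id) (g := cst v0))//.
    by rewrite derive_cst scaler0 add0r derive_id scale1r.
  have dS : differentiable S (l 0).
    by rewrite l0; exact: local_rep_differentiable sS Op ip.
  have dT : differentiable T (l 0).
    by rewrite l0; exact: local_rep_differentiable tS Op ip.
  have dSl : differentiable (S \o l) 0 by exact: differentiable_comp.
  have dTl : differentiable (T \o l) 0 by exact: differentiable_comp.
  have did : differentiable (id : R^o -> R^o) 0 by [].
  have dscale : differentiable (fun tau : R^o => tau *: (T \o l) tau) 0.
    exact: (differentiable_scale did dTl).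
  have dsum : differentiable
    (fun tau : R^o => (S \o l) tau + tau *: (T \o l) tau) 0.
    exact: differentiableD.
  have [_ ->] := derive_row_mx (1 : R^o) dl dsum.
  rewrite Dl [X in row_mx _ X]deriveD;
    [|exact: diff_derivable|exact: diff_derivable].
  rewrite derive_comp// Dl l0 (derive_scale (1 : R^o) did dTl) scale0r add0r.
  by rewrite derive_id scale1r /= l0.
split.
  apply: fibreD; first exact: (complete_lift_fibre mM vA oO sS pvO).
  exact: (vertical_lift_fibre tS pvO).
exists i, U, c; split.
- by split=> //; split.
- move=> tau /lU /(coordsP mM)[Oq iq _]; split.
    split=> //=; apply: fibreD; first exact: sA.
    by apply: fibreZ; exact: tA.
  by rewrite /= addrC; apply: Blin => //; [exact: tB|exact: sB].
- apply: (smooth_eq oU (f := gamma)); first by move=> tau /cE.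
  apply: smooth_row_mx => //.
  apply: smoothD => //.
    exact: (smooth_comp oU oC lU CU (Cs i)).
  apply: smoothZ => //; first exact: smooth_id.
  exact: (smooth_comp oU oC lU CU (Ct i)).
- by rewrite cE// wE row_mxKl /gamma l0 scale0r addr0.
rewrite wE row_mxKr -D0.
apply: near_eq_derive; apply: (open_near_eq oU U0); exact: cE.
Qed.

Definition lift_comb m (b : 'I_m -> pt M -> components M r) (c d : 'I_m -> R)
  (pv : pt TM) :
    components TM (r + r) :=
  \sum_k c k *: complete_lift (b k) pv + \sum_k d k *: vertical_lift (b k) pv.

(** With [F] the matrix of the frame, the components are [c F] and [c (D_v F) +
    d F]: the product rule for the vector [c F] when [d] is the derivative of
    [c]. *)
Lemma lift_combE m O (b : 'I_m -> pt M -> components M r) (c d : 'I_m -> R) i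
  (pv : pt TM) :
  (forall k, section A O (b k)) -> O pv.1 -> dom i pv.1 ->
  lift_comb b c d pv i =
  row_mx ((\row_k c k) *m frame_mx b i pv.1)
    ((\row_k c k) *m 'D_(pv.2 i) (frame_mx b i \o param i) (coord i pv.1) +
     (\row_k d k) *m frame_mx b i pv.1).
Proof.
move=> bS Op ip.
transitivity (\sum_k (c k *: complete_lift (b k) pv) i +
              \sum_k (d k *: vertical_lift (b k) pv) i).
  by rewrite /lift_comb !fct_sumE.
have E1 k : (c k *: complete_lift (b k) pv) i =
    row_mx (c k *: b k pv.1 i)
      (c k *: 'D_(pv.2 i) (local_rep (b k) i) (coord i pv.1)).
  by rewrite fctE complete_liftE// scale_row_mx.
have E2 k : (d k *: vertical_lift (b k) pv) i = row_mx 0 (d k *: b k pv.1 i).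
  by rewrite fctE vertical_liftE// scale_row_mx scaler0.
rewrite (eq_bigr _ (fun k _ => E1 k)) (eq_bigr _ (fun k _ => E2 k)).
rewrite !sum_row_mx add_row_mx [\sum_(_ < _) 0]big1// addr0 -!frame_mxE
  !fct_sumE.
congr row_mx; congr (_ + _).
rewrite mulmx_sum_row; apply: eq_bigr => k _; rewrite mxE; congr (_ *: _).
have df : differentiable (frame_mx b i \o param i) (coord i pv.1).
  apply: differentiable_mx => k' a.
  rewrite (_ : (fun y => _) = fun y => local_rep (b k') i y 0 a).
    apply: differentiable_comp (differentiable_coord _ _ _).
    exact: local_rep_differentiable (bS k') Op ip.
  by apply/funext => y; rewrite /= mxE.
apply/rowP => a.
have E : (fun y => (frame_mx b i \o param i) y k a : R^o) =
         (fun y => local_rep (b k) i y 0 a).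
  by apply/funext => y; rewrite [(_ \o _) y]/= mxE.
rewrite [RHS]mxE (derive_entry _ _ _ df) E.
exact: (derive_entry _ _ _ (local_rep_differentiable (bS k) Op ip)).
Qed.

Lemma frame_mx_differentiable m O (b : 'I_m -> pt M -> components M r) i p :
  open_in O ->
  (forall k, section A O (b k)) -> O p -> dom i p ->
  differentiable (frame_mx b i \o param i) (coord i p).
Proof.
move=> oO bS Op ip; apply: smooth_differentiable (smooth_frame_mx i oO bS) _.
exact: coords_coord.
Qed.

Lemma lift_comb_fibre m O (b : 'I_m -> pt M -> components M r) (c d : 'I_m -> R)
  (pv : pt TM) :
  open_in O -> (forall k, section A O (b k)) -> tangent_over O pv ->
  fibre TA pv (lift_comb b c d pv).
Proof.
move=> oO bS pvO; apply: fibreD; apply: fibre_sum => k; apply: fibreZ.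
  exact: complete_lift_fibre (bS k) pvO.
exact: vertical_lift_fibre (bS k) pvO.
Qed.

Lemma lift_comb_mem m O (b : 'I_m -> pt M -> components M r) (c d : 'I_m -> R)
  (pv : pt TM) :
  local_frame A B O b -> tangent_over O pv -> TB pv (lift_comb b c d pv).
Proof.
move=> bF pvO; have [oO bS BE _] := bF; have [Op _] := pvO.
have subS (a : 'I_m -> R) : subsection A B O (fun q => \sum_k a k *: b k q).
  split=> [|q Oq]; last by rewrite BE//; exists a.
  exact: (section_sum _ oO
    (fun k => sectionZ oO (bS k) (smooth_fun_cst O (a k)))).
have Blin q : O q -> forall (a : R) xi eta, B q xi -> B q eta ->
  B q (a *: xi + eta).
  by move=> Oq a xi eta; exact: local_frame_linear bF Oq.
have := tangent_subbundle_curve oO Blin (subS c) (subS d) pvO.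
set w := _ + _; suff -> : w = lift_comb b c d pv by [].
have [i _ ip] : carrier M pv.1 by have [+ _] := oO; apply.
apply: (fibre_eq (A := TA) (i := i) (p := pv)).
- by split=> //; case: pvO.
- apply: fibreD; [exact: complete_lift_fibre (subS c).1
  pvO|exact: vertical_lift_fibre (subS d).1 pvO].
- exact: lift_comb_fibre pvO.
rewrite (lift_combE _ _ bS)// /w fctE complete_liftE// vertical_liftE//
  add_row_mx addr0.
rewrite !frame_mxE; congr row_mx; congr (_ + _).
have -> : local_rep (fun q => \sum_k c k *: b k q) i =
    (fun x => (\row_k c k) *m (frame_mx b i \o param i) x).
  by apply/funext => x; rewrite /local_rep frame_mxE.
have df := frame_mx_differentiable oO bS Op ip.
rewrite (derive_mulmx (pv.2 i) (differentiable_cst (\row_k c k) (coord i pv.1))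
  df).
by rewrite [X in X *m _ + _]derive_cst mul0mx add0r.
Qed.

(** Along a curve in [B] the components are [xi = mu F], with [mu = xi H] smooth
    for a coframe [H]. By the product rule the velocity is [mu (D_v F) + mu' F],
    so the coefficients are [mu] and [mu'] at 0. *)
Lemma tangent_subbundle_span m O (b : 'I_m -> pt M -> components M r)
  (pv : pt TM) w :
  local_frame A B O b -> tangent_over O pv -> TB pv w ->
  exists c d : 'I_m -> R, w = lift_comb b c d pv.
Proof.
move=> bF pvO [wA [i [U [c [[ip [oU U0]] cB Cc c0 Dc]]]]].
rewrite [chart _]/(chart M) in i ip cB Cc c0 Dc *.
have [oO bS BE _] := bF; have [Op _] := pvO.
have [P [H [oP Pp PO Pi [CH bH]]]] := coframe_exists mM vA bF Op ip.
pose gam (tau : R^o) : 'rV[R]_(n + r) := coord (a := total A) i (c tau).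
pose x tau : 'rV[R]_n := lsubmx (gam tau).
pose xi tau : 'rV[R]_r := rsubmx (gam tau).
have xE tau : x tau = coord i (c tau).1 by rewrite /x /gam /= row_mxKl.
have xiE tau : xi tau = (c tau).2 i by rewrite /xi /gam /= row_mxKr.
have Cx : smooth U x by exact: smooth_lsubmx.
have Cxi : smooth U xi by exact: smooth_rsubmx.
have oC := open_coords (i := i) oP.
(* the times at which the curve lies over the domain of the coframe *)
pose V : set R^o := [set tau | U tau /\ coords i P (x tau)].
have oV : open V by exact: open_preimage oU oC Cx.
have x0 : x 0 = coord i pv.1 by rewrite /x /gam c0 row_mxKl.
have V0 : V 0 by split=> //; rewrite x0; exact: coords_coord.
pose h := H i \o param i; pose F := frame_mx b i \o param i.
have bSP k : section A P (b k) by exact: section_sub (bS k).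
have CF : smooth (coords i P) F by exact: smooth_frame_mx.
have VU : V `<=` U by move=> tau [].
have Ch : smooth V (fun tau => h (x tau)).
  apply: (smooth_comp oV oC) (CH i); first by move=> tau [].
  exact: smooth_sub Cx.
pose mu tau := xi tau *m h (x tau).
have Cmu : smooth V mu by apply: smooth_mulmx => //; exact: smooth_sub Cxi.
have xi_mu tau : V tau -> mu tau *m F (x tau) = xi tau.
  move=> [Utau xP]; have [[iq _] Bq] := cB _ Utau.
  have pE : param i (x tau) = (c tau).1 by rewrite xE coordK.
  have Pq : P (c tau).1 by have /(coordsP mM)[+ _ _] := xP; rewrite pE.
  have [a aE] : exists a : 'I_m -> R, (c tau).2 = \sum_k a k *: b k (c tau).1.
    by have := Bq; rewrite BE//; exact: PO.
  rewrite /mu /h /F /= pE xiE aE frame_mxE -(mulmxA (\row_k a k)) bH// mulmx1.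
  by [].
have dx : differentiable x 0 by exact: smooth_differentiable Cx _.
have dxi : differentiable xi 0 by exact: smooth_differentiable Cxi _.
have [_ Dg] := derive_row_mx (1 : R^o) dx dxi.
have [Dx Dxi] : 'D_1 x 0 = pv.2 i /\ 'D_1 xi 0 = rsubmx (w i).
  have E : (fun tau => row_mx (x tau) (xi tau)) = gam.
    by apply/funext => tau; rewrite hsubmxK.
  by move: Dg; rewrite E [LHS]Dc => /eq_row_mx[-> ->].
have xi0 : xi 0 = lsubmx (w i) by rewrite /xi /gam c0 row_mxKr.
have dF : differentiable F (x 0).
  by rewrite x0; apply: smooth_differentiable CF _; exact: coords_coord.
exists (fun k => mu 0 0 k), (fun k => ('D_1 mu 0) 0 k).
apply: (fibre_eq (A := TA) (i := i) (p := pv)) => //.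
- by split=> //; case: pvO.
- exact: lift_comb_fibre pvO.
rewrite (lift_combE _ _ bS)// -[LHS]hsubmxK.
have row_of k' (a : 'rV[R]_k') : \row_k a 0 k = a by apply/rowP => k;
  rewrite mxE.
rewrite !row_of; congr row_mx.
  rewrite -xi0 -(xi_mu 0 V0) x0 /F /= coordK//.
rewrite -Dxi.
have -> : 'D_1 xi 0 = 'D_1 (fun tau => mu tau *m (F \o x) tau) 0.
  by apply: near_eq_derive; apply: (open_near_eq oV V0) => tau /xi_mu.
rewrite derive_mulmx; last 2 first.
- exact: smooth_differentiable Cmu _.
- exact: differentiable_comp.
rewrite (derive_comp _ dx dF) Dx x0 addrC; congr (_ + _).
by rewrite [(_ \o _) _]/= x0 /F /= coordK.
Qed.

Definition lift_frame m (b : 'I_m -> pt M -> components M r) (k : 'I_(m + m)) :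
    pt TM -> components TM (r + r) :=
  match fintype.split k with
  | inl a => complete_lift (b a)
  | inr a => vertical_lift (b a)
  end.

Lemma lift_frame_sum m (b : 'I_m -> pt M -> components M r)
  (c : 'I_(m + m) -> R) (pv : pt TM) :
  \sum_k c k *: lift_frame b k pv =
  lift_comb b (fun k => c (lshift m k)) (fun k => c (rshift m k)) pv.
Proof.
rewrite big_split_ord/=; congr (_ + _); apply: eq_bigr => k _.
  by rewrite /lift_frame split_lshift.
by rewrite /lift_frame split_rshift.
Qed.

Lemma lift_frame_section m O (b : 'I_m -> pt M -> components M r) k :
  open_in O ->
  (forall k, section A O (b k)) -> section TA (tangent_over O) (lift_frame b k).
Proof.
move=> oO bS; rewrite /lift_frame; case: fintype.split => a.
  exact: complete_lift_section.
exact: vertical_lift_section.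
Qed.

(** The lifts of a frame of [B] form a frame of TB, by [lift_comb_mem] and
    [tangent_subbundle_span]; they are independent because their matrix of
    components is block triangular. *)
Lemma lift_local_frame m O (b : 'I_m -> pt M -> components M r) :
  local_frame A B O b -> local_frame TA TB (tangent_over O) (lift_frame b).
Proof.
move=> bF; have [oO bS BE bI] := bF; split.
- exact: open_in_tangent_over.
- by move=> k; exact: lift_frame_section.
- move=> pv pvO; apply/seteqP; split=>
  [w /(tangent_subbundle_span bF pvO)[c [d ->]]|w [c ->]].
    exists (fun k => match fintype.split k with inl a => c a | inr a =>
      d a end).
    rewrite lift_frame_sum; congr lift_comb; apply/funext => k.
      by rewrite split_lshift.
    by rewrite split_rshift.
  by rewrite lift_frame_sum; exact: (lift_comb_mem _ _ bF pvO).
move=> pv pvO c; rewrite lift_frame_sum => E.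
have [Op _] := pvO.
have [i _ ip] : carrier M pv.1 by have [+ _] := oO; apply.
have fib (a : 'I_m -> R) : fibre A pv.1 (\sum_k a k *: b k pv.1).
  by apply: fibre_sum => k; apply: fibreZ; have [+ _] := bS k; apply.
have zero (a : 'I_m -> R) : (\row_k a k) *m frame_mx b i pv.1 = 0 -> forall k,
  a k = 0.
  move=> a0; apply: (bI _ Op); apply: (fibre_eq ip (fib a) (fibre0 A _)).
  by rewrite frame_mxE a0.
have := congr1 (fun f : components TM (r + r) => f i) E.
rewrite (lift_combE _ _ bS)// => /esym E0.
have /eq_row_mx[/esym Ec /esym Ed] : row_mx 0 0 = row_mx _ _ :=
  etrans (row_mx0 _ _ _ _) E0.
have c0 := zero _ Ec.
rewrite (_ : \row_k c (lshift m k) = 0) ?mul0mx ?add0r in Ed; last first.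
  by apply/rowP => k; rewrite !mxE.
have d0 := zero _ Ed.
by move=> k; rewrite -(splitK k); case: fintype.split => a /=;
  [exact: c0|exact: d0].
Qed.

Lemma tangent_subbundle_is_subbundle : is_subbundle A B -> is_subbundle TA TB.
Proof.
move=> [m Bm]; exists (m + m)%N => pv [i _ [/= ip vp]].
have [Q [b bF]] := Bm _ (carrier_dom ip).
have bF' : local_frame A B Q b by case: bF.
have Qp : Q pv.1 by case: bF.
have [oT bS BE bI] := lift_local_frame bF'.
by exists (tangent_over Q), (lift_frame b); split.
Qed.

End TangentSubbundle.

(** * Brackets with sections of a subbundle *)

Section Brackets.
Context {R : realType} (n r : nat) (M : atlas R n) (A : bundle M r)
  (L : algebroid_structure M r).
Hypothesis mM : is_manifold M.
Hypothesis vA : is_vector_bundle A.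
Hypothesis lL : is_lie_algebroid A L.
Implicit Types (i j : chart M) (p q : pt M) (O Q : set (pt M))
  (s t : pt M -> components M r) (B : pt M -> set (components M r)).

Lemma bracket0 O t p :
  open_in O -> section A O t -> O p -> bracket L O 0 t p = 0.
Proof.
move=> oO tS Op; have s0 : section A O (0 : pt M -> components M r)
  by exact: section0.
have := bracket_linear lL 1 oO s0 s0 tS Op.
rewrite scale1r addr0 scale1r => E; apply: (addrI (bracket L O 0 t p)).
by rewrite addr0 -E.
Qed.

(** The Leibniz rule on the left. The scalar [a] is a derivative of [f]; only
    its existence matters, as the term [a *: s p] stays in the subbundle. *)
Lemma bracketZl O s t (f : pt M -> R^o) p : open_in O -> section A O s ->
  section A O t -> smooth_fun O f -> O p ->
  exists a : R, bracket L O (fun q => f q *: s q) t p = f p *: bracket L O s t p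
    + a *: s p.
Proof.
move=> oO sS tS Cf Op; have [i _ ip] : carrier M p by have [+ _] := oO; apply.
exists (- deriv i p (anchor L p (t p)) f).
rewrite (bracket_skew lL oO (sectionZ oO sS Cf) tS Op).
rewrite (bracket_leibniz lL oO tS sS Cf Op ip) (bracket_skew lL oO tS sS Op).
by rewrite opprD scalerN opprK scaleNr.
Qed.

Lemma bracket_comb_mem O p N (f : 'I_N -> pt M -> R^o)
    (e : 'I_N -> pt M -> components M r) t (P : set (components M r)) :
  open_in O -> O p -> (forall k, section A O (e k)) ->
    (forall k, smooth_fun O (f k)) ->
  section A O t -> P 0 ->
  (forall (c : R) xi eta, P xi -> P eta -> P (c *: xi + eta)) ->
  (forall k, P (e k p)) -> (forall k, P (bracket L O (e k) t p)) ->
  P (bracket L O (fun q => \sum_k f k q *: e k q) t p).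
Proof.
move=> oO Op eS Cf tS P0 Plin Pe Pb.
have feS k : section A O (fun q => f k q *: e k q) by exact: sectionZ.
elim: (index_enum _) => [|k l IH].
  rewrite (_ : (fun q => _) = 0); first by rewrite bracket0.
  by apply/funext => q; rewrite big_nil.
have rS := section_sum l oO feS.
have -> : (fun q => \sum_(k <- k :: l) f k q *: e k q) =
    1 *: (fun q => f k q *: e k q) + (fun q => \sum_(k <- l) f k q *: e k q).
  by apply/funext => q; rewrite big_cons scale1r.
rewrite (bracket_linear lL 1 oO (feS k) rS tS Op).
apply: (Plin) => //.
have [a ->] := bracketZl oO (eS k) tS (Cf k) Op.
by apply: (Plin) => //; rewrite -[a *: _]addr0; exact: Plin.
Qed.

(** The condition that [[s, t]] lies in [B] for all sections [s] of [B] can be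
    tested on a local frame, since the bracket is local and the Leibniz rule
    only adds multiples of the frame. The open sets [Q'] range over
    neighbourhoods so small that the coefficients of [s] are defined. *)
Lemma bracket_frame_mem m B O Q (b : 'I_m -> pt M -> components M r) p s t :
  local_frame A B O b -> O p -> open_in Q -> Q p ->
  subsection A B Q s -> section A Q t ->
  (forall Q', open_in Q' -> Q' p -> Q' `<=` O -> Q' `<=` Q ->
     forall k, B p (bracket L Q' (b k) t p)) ->
  B p (bracket L Q s t p).
Proof.
move=> bF Op oQ Qp sS tS H; have [oO bS BE bI] := bF.
have [P [oP Pp PO coef]] := smooth_coefficients mM vA bF Op.
pose Q' := P `&` Q.
have oQ' : open_in Q' by exact: open_inI.
have Q'P : Q' `<=` P by move=> q [].
have Q'Q : Q' `<=` Q by move=> q [].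
have Q'O : Q' `<=` O by move=> q [/PO].
have Q'p : Q' p by [].
have [sQ sB] := sS.
have sS' : subsection A B Q' s.
  by split; [exact: section_sub sQ|move=> q /Q'Q/sB].
have [f [Cf sE]] := coef _ _ oQ' Q'P sS'.
have bS' k : section A Q' (b k) by exact: section_sub (bS k).
have tS' : section A Q' t by exact: section_sub tS.
have cS : section A Q' (fun q => \sum_k f k q *: b k q).
  by apply: section_sum => // k; exact: sectionZ.
rewrite (bracket_local lL oQ oQ' Q'Q sQ tS cS tS' sE (fun q _ => erefl) Q'p).
apply: bracket_comb_mem => //.
- exact: local_frame0 bF Op.
- by move=> c xi eta; exact: local_frame_linear bF Op.
- by move=> k; exact: local_frame_mem bF Op.
- by move=> k; exact: H.
Qed.

Lemma anchor_sum N (c : 'I_N -> R) (e : 'I_N -> components M r) p :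
  carrier M p ->
  (forall k, fibre A p (e k)) ->
  anchor L p (\sum_k c k *: e k) = \sum_k c k *: anchor L p (e k).
Proof.
move=> Mp eA.
have a0 : anchor L p 0 = 0.
  have := anchor_linear lL 1 Mp (fibre0 A p) (fibre0 A p).
  rewrite scale1r addr0 scale1r => E; apply: (addrI (anchor L p 0)).
  by rewrite addr0 -E.
elim: (index_enum _) => [|k l IH]; first by rewrite !big_nil a0.
rewrite !big_cons (anchor_linear lL)// ?IH//.
by apply: fibre_sum => k'; exact: fibreZ.
Qed.

End Brackets.

(** * TB is a Lie subalgebroid, and lifts of foliated sections are foliated *)

Section TangentAlgebroid.
Context {R : realType} (n r : nat) (M : atlas R n) (A : bundle M r)
  (L : algebroid_structure M r) (B : pt M -> set (components M r))
  (TL : algebroid_structure (tangent_manifold M) (r + r)).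
Hypothesis mM : is_manifold M.
Hypothesis vA : is_vector_bundle A.
Hypothesis lL : is_lie_algebroid A L.
Local Notation TM := (tangent_manifold M).
Local Notation TA := (tangent_lift_bundle A).
Local Notation TB := (tangent_subbundle A B).
Hypothesis lTL : is_lie_algebroid TA TL.
Hypothesis tTL : is_tangent_structure A L TL.
Hypothesis sB : is_lie_subalgebroid A L B.
Implicit Types (i j : chart M) (p q : pt M) (O : set (pt M)) (Q : set (pt TM))
  (s t : pt M -> components M r).
Let mT : is_manifold TM := tangent_manifold_is_manifold mM.
Let vTA : is_vector_bundle TA := tangent_lift_vector_bundle mM vA.

Lemma local_frame_at O p : open_in O -> O p ->
  exists m O' (b : 'I_m -> pt M -> components M r),
    [/\ local_frame A B O' b, O' p & O' `<=` O].
Proof.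
move=> oO Op; have [[m Bm] _] := sB; exists m.
have [P [b [oP Pp bS BE bI]]] := Bm _ (proj1 oO _ Op).
have oPO : open_in (P `&` O) by exact: open_inI.
have bF : local_frame A B P b by [].
have bFO : local_frame A B (P `&` O) b by apply: local_frameS bF => // q [].
by exists (P `&` O), b; split=> // q [].
Qed.

Lemma subbundle_linear p (c : R) xi eta : carrier M p ->
  B p xi -> B p eta -> B p (c *: xi + eta).
Proof.
move=> [i _ ip].
have [m [P [b [bF Pp _]]]] := local_frame_at (open_in_dom mM i) ip.
exact: local_frame_linear bF Pp.
Qed.

Lemma subbundle0 p : carrier M p -> B p 0.
Proof.
move=> [i _ ip].
have [m [P [b [bF Pp _]]]] := local_frame_at (open_in_dom mM i) ip.
exact: local_frame0 bF Pp.
Qed.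

Lemma complete_lift_mem O s (pv : pt TM) : open_in O -> subsection A B O s ->
  tangent_over O pv -> TB pv (complete_lift s pv).
Proof.
move=> oO sS pvO.
have zS : subsection A B O (0 : pt M -> components M r).
  by split; [exact: section0|move=> q Oq; apply: subbundle0; exact: (proj1 oO)].
have Blin q : O q -> forall (a : R) xi eta, B q xi -> B q eta ->
  B q (a *: xi + eta).
  by move=> Oq a xi eta; apply: subbundle_linear; exact: (proj1 oO).
have := tangent_subbundle_curve mM vA oO Blin sS zS pvO.
rewrite (_ : vertical_lift _ pv = 0) ?addr0//.
apply/funext => i; rewrite /vertical_lift; case: ifP => // _.
by rewrite row_mx0.
Qed.

Lemma vertical_lift_mem O s (pv : pt TM) : open_in O -> subsection A B O s ->
  tangent_over O pv -> TB pv (vertical_lift s pv).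
Proof.
move=> oO sS pvO.
have zS : subsection A B O (0 : pt M -> components M r).
  by split; [exact: section0|move=> q Oq; apply: subbundle0; exact: (proj1 oO)].
have Blin q : O q -> forall (a : R) xi eta, B q xi -> B q eta ->
  B q (a *: xi + eta).
  by move=> Oq a xi eta; apply: subbundle_linear; exact: (proj1 oO).
have := tangent_subbundle_curve mM vA oO Blin zS sS pvO.
rewrite (_ : complete_lift _ pv = 0) ?add0r//.
apply/funext => i; rewrite /complete_lift; case: ifP => // _.
by rewrite [X in row_mx _ X]derive_cst row_mx0.
Qed.

Lemma tangent_subbundle_linear (pv : pt TM) (c : R) xi eta : carrier TM pv ->
  TB pv xi -> TB pv eta -> TB pv (c *: xi + eta).
Proof.
move=> [i _ [/= ip vp]] xB eB.
have [m [P [b [bF Pp _]]]] := local_frame_at (open_in_dom mM i) ip.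
exact: (local_frame_linear c (lift_local_frame mM vA bF) (conj Pp vp) xB eB).
Qed.

Lemma tangent_subbundleN (pv : pt TM) xi :
  carrier TM pv -> TB pv xi -> TB pv (- xi).
Proof.
move=> Cpv xB; have := tangent_subbundle_linear (-1 - 1) Cpv xB xB.
by rewrite scalerBl scaleN1r scale1r subrK.
Qed.

(** Lets [lift_bracket_mem] cover the four kinds of brackets of lifts. *)
Definition is_lift s (S : pt TM -> components TM (r + r)) : Prop :=
  S = complete_lift s \/ S = vertical_lift s.

(** The bracket of two lifts is the complete or vertical lift of [[s, t]], or 0,
    and lifts of sections of [B] lie in TB. The relations that define the
    bracket of TA concern sections over preimages of open sets of [M]; the
    smaller [Q] is reached by locality. *)
Lemma lift_bracket_mem O Q s t S T (pv : pt TM) :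
  open_in O -> section A O s -> section A O t ->
  subsection A B O (bracket L O s t) ->
  is_lift s S -> is_lift t T ->
  open_in Q -> Q pv -> Q `<=` tangent_over O ->
  TB pv (bracket TL Q S T pv).
Proof.
move=> oO sS tS stS lS lT oQ Qpv QO.
have pvO := QO _ Qpv; have [Op vp] := pvO.
have oT := open_in_tangent_over mM oO.
have sect u U : section A O u -> is_lift u U -> section TA (tangent_over O) U.
  by move=> uS [->|->];
    [exact: complete_lift_section|exact: vertical_lift_section].
have SS := sect _ _ sS lS; have TS := sect _ _ tS lT.
rewrite -(bracket_local lTL oT oQ QO SS TS (section_sub QO SS)
  (section_sub QO TS)
  (fun _ _ => erefl) (fun _ _ => erefl) Qpv).
case: lS lT => -> [] ->.
- by rewrite (tangent_bracket_CC tTL)//; exact: complete_lift_mem stS pvO.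
- by rewrite (tangent_bracket_CV tTL)//; exact: vertical_lift_mem stS pvO.
- rewrite (bracket_skew lTL oT);
  [|exact: vertical_lift_section|exact: complete_lift_section|exact: pvO].
  rewrite (tangent_bracket_CV tTL)//.
  rewrite (_ : - _ = vertical_lift (bracket L O s t) pv).
    exact: vertical_lift_mem stS pvO.
  apply/funext => i; rewrite fctE /vertical_lift; case: ifP => _;
    last by rewrite oppr0.
  by rewrite (bracket_skew lL oO sS tS Op) fctE opp_row_mx oppr0.
rewrite (tangent_bracket_VV tTL)//.
have [m [P [b [bF Pp _]]]] := local_frame_at oO Op.
exact: (local_frame0 (lift_local_frame mM vA bF)).
Qed.

Lemma lift_frame_is_lift m (b : 'I_m -> pt M -> components M r) k :
  exists a, is_lift (b a) (lift_frame b k).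
Proof.
by rewrite /lift_frame; case: fintype.split => a; exists a; [left|right].
Qed.

(** [bracket_frame_mem] in each argument reduces the closure of TB to the
    brackets of the lifts of a frame of [B]. *)
Lemma tangent_lie_subalgebroid : is_lie_subalgebroid TA TL TB.
Proof.
have [sub brB] := sB.
split; first exact: tangent_subbundle_is_subbundle.
move=> Q S T oQ SS TS; split; first exact: (bracket_section lTL oQ SS.1 TS.1).
move=> pv Qpv.
have [i _ [/= ip vp]] : carrier TM pv by have [+ _] := oQ; apply.
have [m [P [b [bF Pp _]]]] := local_frame_at (open_in_dom mM i) ip.
have [oP bS BE bI] := bF.
have tF := lift_local_frame mM vA bF.
have pvO : tangent_over P pv by [].
have bB k : subsection A B P (b k).
  by split=> // q Pq; exact: local_frame_mem bF Pq.
apply: (bracket_frame_mem mT vTA lTL tF pvO oQ Qpv SS TS.1) =>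
  Q' oQ' Q'pv Q'O Q'Q k.
have kS : section TA Q' (lift_frame b k).
  by apply: section_sub Q'O _; exact: lift_frame_section.
have TS' : subsection TA TB Q' T.
  by split; [exact: section_sub Q'Q TS.1|move=> q /Q'Q; exact: TS.2].
rewrite (bracket_skew lTL oQ' kS TS'.1 Q'pv); apply: tangent_subbundleN.
  by have [+ _] := oQ'; apply.
apply: (bracket_frame_mem mT vTA lTL tF pvO oQ' Q'pv TS' kS) =>
  Q2 oQ2 Q2pv Q2O Q2Q l.
have [a la] := lift_frame_is_lift b l; have [a' ka] := lift_frame_is_lift b k.
apply: (lift_bracket_mem oP (bS a) (bS a') _ la ka oQ2 Q2pv Q2O).
exact: brB.
Qed.

(** The same reduction: [[b, a]] is a section of [B] for each [b] of a frame of
    [B], so the brackets of the lifts of [b] and [a] lie in TB. *)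
Lemma foliated_lift O a T : open_in O -> B_foliated A L B O a -> is_lift a T ->
  B_foliated TA TL TB (tangent_over O) T.
Proof.
move=> oO [aS aB] lT.
have TS : section TA (tangent_over O) T.
  by case: lT => ->; [exact: complete_lift_section|exact:
    vertical_lift_section].
split=> // Q S oQ QO SS; have TSQ := section_sub QO TS.
split; first exact: (bracket_section lTL oQ SS.1 TSQ).
move=> pv Qpv; have [Op vp] := QO _ Qpv.
have [m [P [b [bF Pp PO]]]] := local_frame_at oO Op.
have [oP bS BE bI] := bF.
have tF := lift_local_frame mM vA bF.
have pvP : tangent_over P pv by [].
apply: (bracket_frame_mem mT vTA lTL tF pvP oQ Qpv SS TSQ) =>
  Q' oQ' Q'pv Q'O Q'Q k.
have [l kl] := lift_frame_is_lift b k.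
apply: (lift_bracket_mem oP (bS l) (section_sub PO aS) _ kl _ oQ' Q'pv Q'O) =>
  //.
apply: aB => //; split=> // q Pq; exact: local_frame_mem bF Pq.
Qed.

End TangentAlgebroid.

(** * The image of TB under the anchor *)

Section TangentAnchor.
Context {R : realType} (n r : nat) (M : atlas R n) (tr : {set 'I_n})
  (A : bundle M r)
  (L : algebroid_structure M r) (B : pt M -> set (components M r))
  (TL : algebroid_structure (tangent_manifold M) (r + r)).
Hypothesis fM : is_foliated_manifold M tr.
Hypothesis vA : is_vector_bundle A.
Hypothesis lL : is_lie_algebroid A L.
Local Notation TM := (tangent_manifold M).
Local Notation TA := (tangent_lift_bundle A).
Local Notation TB := (tangent_subbundle A B).
Hypothesis lTL : is_lie_algebroid TA TL.
Hypothesis tTL : is_tangent_structure A L TL.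
Hypothesis fB : is_foliation_of tr A L B.
Implicit Types (i j : chart M) (p q : pt M) (O : set (pt M)) (Q : set (pt TM))
  (s t : pt M -> components M r).
Let mM : is_manifold M := foliated_is_manifold fM.
Let vT : is_vector_bundle (tangent_bundle M) := tangent_vector_bundle mM.
Let mT : is_manifold TM := tangent_manifold_is_manifold mM.
Let vTT : is_vector_bundle (tangent_bundle TM) := tangent_vector_bundle mT.

Lemma tangent_anchor_lift_comb m O (b : 'I_m -> pt M -> components M r)
  (c d : 'I_m -> R)
    (pv : pt TM) : open_in O -> (forall k, section A O (b k)) ->
      tangent_over O pv ->
  anchor TL pv (lift_comb b c d pv) =
  lift_comb (fun k => anchor_section L (b k)) c d pv.
Proof.
move=> oO bS pvO.
have Cpv : carrier TM pv by have [+ _] := open_in_tangent_over mM oO; apply.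
have Cf k : fibre TA pv (complete_lift (b k) pv) by exact: complete_lift_fibre
  (bS k) pvO.
have Vf k : fibre TA pv (vertical_lift (b k) pv) by exact: vertical_lift_fibre
  (bS k) pvO.
rewrite /lift_comb -[X in anchor TL pv (X + _)]scale1r (anchor_linear lTL)//;
  last 2 first.
- by apply: fibre_sum => k; exact: fibreZ.
- by apply: fibre_sum => k; exact: fibreZ.
rewrite scale1r !(anchor_sum lTL)//; congr (_ + _); apply: eq_bigr => k _.
  by rewrite (tangent_anchor_C tTL oO).
by rewrite (tangent_anchor_V tTL oO).
Qed.

(** Vanishing of the transverse components in one chart suffices, because the
    changes of charts are adapted. *)
Lemma leafwise_vector i p (Z : 'rV[R]_n) : dom i p ->
  (forall a, a \in tr -> Z 0 a = 0) ->
    tangent_to_leaves tr p (vector_in (tangent_bundle M) i p Z).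
Proof.
move=> ip Z0; split; first exact: vector_in_fibre.
move=> j jp a at_; rewrite /vector_in asboolT// mxE big1// => u _.
have [ut|ut] := boolP (u \in tr); first by rewrite Z0// mul0r.
by rewrite (foliated_change fM)// mulr0.
Qed.

(** With [X] the matrix of the anchors of a frame of [B], the anchor of the
    combination [(c, d)] of lifts has components [c X] and [c (D_v X) + d X].
    The transverse columns of [X] vanish identically, hence so do those of [D_v
    X]. Conversely [c] is found by solving [c X = V1], and then [d] by solving
    [d X = V2 - c (D_v X)], as the rows of [X] span the vectors tangent to the
    leaves. *)
Lemma tangent_anchor_image (pv : pt TM) : carrier TM pv ->
  anchor TL pv @` TB pv = tangent_to_leaves (tangent_foliation tr) pv.
Proof.
move=> Cpv; have [i0 _ [/= ip0 vp]] := Cpv.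
have [i ip] : exists i : chart M, dom i pv.1 by exists i0.
have sB := foliation_subalgebroid fB.
have [m [P [b [bF Pp _]]]] := local_frame_at mM sB (open_in_dom mM i) ip.
have [oP bS BE bI] := bF.
have pvP : tangent_over P pv by [].
pose X k := anchor_section L (b k).
have XS k : section (tangent_bundle M) P (X k)
  by exact: (anchor_smooth lL oP (bS k)).
have Xleaf k q : P q -> tangent_to_leaves tr q (X k q).
  move=> Pq; have Cq : carrier M q by exact: (proj1 oP).
  rewrite -(foliation_anchor fB Cq); exists (b k q) => //.
  exact: local_frame_mem bF Pq.
have Xmx0 j q a k : P q -> dom j q -> a \in tr -> frame_mx X j q k a = 0.
  by move=> Pq jq at_; rewrite mxE; have [_ /(_ j jq a at_)] := Xleaf k q Pq.
have DXmx0 j a k : dom j pv.1 -> a \in tr ->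
    ('D_(pv.2 j) (frame_mx X j \o param j) (coord j pv.1)) k a = 0.
  move=> jp at_; rewrite derive_entry;
    last exact: frame_mx_differentiable XS _ _.
  rewrite -[RHS](derive_cst (0 : R^o) (coord j pv.1) (pv.2 j)).
  apply: near_eq_derive; near=> x.
  have : coords j P x by near: x; exact: near_coords.
  by move=> /(coordsP mM)[Pq jq _]; rewrite /= Xmx0.
apply/seteqP; split=> [V [w wB <-]|V [VT V0]].
  have [c [d ->]] := tangent_subbundle_span mM vA bF pvP wB.
  rewrite (tangent_anchor_lift_comb c d oP bS pvP); split.
    rewrite -(tangent_anchor_lift_comb c d oP bS pvP).
    apply: (anchor_fibre lTL) => //; exact: lift_comb_fibre bS pvP.
  rewrite [chart _]/(chart M) => j [/= jp _] a.
  rewrite (lift_combE c d XS)//.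
  case: (split_ordP a) => a' ->;
    rewrite ?tangent_foliation_lshift ?tangent_foliation_rshift => at_.
    by rewrite row_mxEl mxE big1// => k _; rewrite Xmx0// mulr0.
  rewrite row_mxEr mxE [X in X + _]mxE [X in _ + X]mxE !big1 ?addr0// => k _.
    by rewrite Xmx0// mulr0.
  by rewrite DXmx0// mulr0.
have iv : dom (a := TM) i pv by [].
have solve (Z : 'rV[R]_n) : (forall a, a \in tr -> Z 0 a = 0) ->
    exists c : 'I_m -> R, (\row_k c k) *m frame_mx X i pv.1 = Z.
  move=> Z0; have := leafwise_vector ip Z0.
  have Cp : carrier M pv.1 by exact: carrier_dom ip.
  rewrite -(foliation_anchor fB Cp) => -[xi xiB xiE].
  have [c cE] : exists c : 'I_m -> R, xi = \sum_k c k *: b k pv.1.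
    by move: xiB; rewrite BE.
  exists c; rewrite -frame_mxE.
  have bf k : fibre A pv.1 (b k pv.1) by have [+ _] := bS k; apply.
  by rewrite -(anchor_sum lL c Cp bf) -cE xiE vector_inE.
pose V1 : 'rV[R]_n := lsubmx (V i); pose V2 : 'rV[R]_n := rsubmx (V i).
have [c cE] : exists c : 'I_m -> R, (\row_k c k) *m frame_mx X i pv.1 = V1.
  by apply: solve => a at_; rewrite mxE V0// tangent_foliation_lshift.
pose D := 'D_(pv.2 i) (frame_mx X i \o param i) (coord i pv.1).
have [d dE] : exists d : 'I_m -> R,
  (\row_k d k) *m frame_mx X i pv.1 = V2 - (\row_k c k) *m D.
  apply: solve => a at_;
    rewrite mxE [X in X + _]mxE V0 ?tangent_foliation_rshift//.
  rewrite add0r mxE [X in - X]mxE big1 ?oppr0// => k _.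
  by rewrite DXmx0// mulr0.
exists (lift_comb b c d pv); first exact: lift_comb_mem bF pvP.
apply: (fibre_eq (A := tangent_bundle TM) iv) => //.
  apply: (anchor_fibre lTL) => //; exact: lift_comb_fibre bS pvP.
rewrite (tangent_anchor_lift_comb c d oP bS pvP) (lift_combE c d XS)//.
by rewrite cE dE addrC subrK hsubmxK.
Unshelve. all: by end_near. Qed.

End TangentAnchor.

(** * Extension of sections by bump functions *)

Section BumpSections.
Context {R : realType} (n r : nat) (M : atlas R n) (A : bundle M r).
Hypothesis mM : is_manifold M.
Implicit Types (i j : chart M) (p q : pt M) (O : set (pt M))
  (s t e : pt M -> components M r).

(** A point outside the domain of [i] is separated from each point of a compact
    subset of the domain, hence from a neighbourhood of it; compactness makes
    one neighbourhood of the point suffice. *)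
Lemma near_avoids_compact i j (K : set 'rV[R]_n) y :
  compact K -> K `<=` coords i (dom i) ->
  coords j (dom j) y -> ~ dom i (param j y) ->
  \forall y' \near y, K `<=` [set z | param j y' <> param i z].
Proof.
move=> /compact_near_coveringP cK Ki /(coordsP mM)[_ jy yE] Nq.
apply: (cK _ (nbhs y) (fun y' z => param j y' <> param i z)) => z Kz.
have /(coordsP mM)[_ iz zE] := Ki _ Kz.
have qz : param j y <> param i z by move=> E; apply: Nq; rewrite E.
have [Q [Q' [oQ oQ' Qq Q'z QQ']]] :=
  manifold_hausdorff mM (carrier_dom jy) (carrier_dom iz) qz.
have nQ : \forall y' \near y, coords j Q y' by have := near_coords oQ Qq jy;
  rewrite yE.
have nQ' : \forall z' \near z, coords i Q' z' by have := near_coords oQ' Q'z iz;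
  rewrite zE.
exists (coords i Q', coords j Q) => //=.
move=> [z' y'] [/= /(coordsP mM)[Q'z' _ _] /(coordsP mM)[Qy' _ _]] E.
have : (Q `&` Q') (param j y') by split=> //; rewrite E.
by rewrite QQ'.
Qed.

(** A section over a chart, multiplied by a bump function of the coordinates,
    extends by 0 to any open set. Smoothness away from the domain of the chart
    comes from the Hausdorff property, through [near_avoids_compact]. *)
Lemma bump_section i p : dom i p ->
  exists f : 'rV[R]_n -> R^o, [/\ smooth setT f, f (coord i p) != 0 &
    forall O e, open_in O -> section A (dom i) e ->
      section A O (fun q =>
        if `[< dom i q >] then f (coord i q) *: e q else 0)].
Proof.
move=> ip; have oi := open_in_dom mM i.
have : nbhs (coord i p) (coords i (dom i)) by exact: near_coords.
move=> /nbhs_ballP[eps /= eps0 epsU].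
have e20 : 0 < eps / 2 by rewrite divr_gt0.
(* half the radius, so that the closed ball is still inside the chart *)
have [f Cf [f0 fK]] := smooth_bump (coord i p) e20.
exists f; split=> // O e oO [eA Ce].
set E := fun q => _.
have EA q : fibre A q (E q).
  rewrite /E; case: asboolP => iq; last exact: fibre0.
  exact/fibreZ/eA.
split=> // j.
pose K := closed_ball_ Num.norm (coord i p) (eps / 2).
have cK : compact K.
  apply: bounded_closed_compact; last exact: closed_closed_ball_.
  exists (`|coord i p| + eps / 2); split; first exact: num_real.
  move=> M' M'lt z /= Kz; apply: le_trans (ltW M'lt).
  rewrite -[z](subrK (coord i p)) addrC (le_trans (ler_normD _ _))// lerD2l.
  by rewrite distrC.
have Ki : K `<=` coords i (dom i).
  move=> z Kz; apply: epsU; rewrite -ball_normE/=.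
  by apply: le_lt_trans Kz _; rewrite ltr_pdivrMr// ltr_pMr// ltr1n.
have oCj := open_coords (i := j) oO.
apply: smooth_local => x xO; have /(coordsP mM)[Oq jq xE] := xO.
have [iq|Nq] := pselect (dom i (param j x)).
  have oOi : open_in (O `&` dom i) by exact: open_inI.
  have oC := open_coords (i := j) oOi.
  exists (coords j (O `&` dom i)); split=> //.
    by apply/(coordsP mM); split.
  apply: (smooth_eq oC (f := fun y =>
    ((f \o coord i) \o param j) y *: local_rep e j y)).
    by move=> y /(coordsP mM)[[_ iy] _ _]; rewrite /E asboolT.
  apply: (smoothZ oC).
    apply: (smooth_from_chart mM oOi (i := i)); first by move=> q [].
    apply: (smooth_eq (open_coords oOi) (f := f)).
      by move=> y /(coordsP mM)[_ _ yE] /=; rewrite yE.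
    exact: smooth_sub Cf.
  by apply: smooth_sub (Ce j); apply: coordsS => q [].
have nx : \forall y \near x,
  coords j O y /\ K `<=` [set z | param j y <> param i z].
  apply: filterI; first by have := near_coords oO Oq jq; rewrite xE.
  apply: near_avoids_compact cK Ki _ Nq; exact: coords_dom xO.
pose S := [set y | coords j O y /\ K `<=` [set z | param j y <> param i z]].
have oW : open (interior S) by exact: open_interior.
exists (interior S); split=> //.
apply: (smooth_eq oW (f := fun=> 0)); last exact: smooth_cst.
move=> y /interior_subset[yO yK]; rewrite /E; case: asboolP => // iy.
rewrite !fctE; have [->|/eqP fy] := eqVneq (f (coord i (param j y))) 0;
  first by rewrite scale0r.
have Ky : K (coord i (param j y)).
  by rewrite /K /closed_ball_ /= distrC; apply/ltW/fK/eqP.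
by have := yK _ Ky; rewrite /= coordK.
Qed.

End BumpSections.

(** * Combinations of foliated sections *)

Section FoliatedSpan.
Context {R : realType} (n r : nat) (M : atlas R n) (A : bundle M r)
  (L : algebroid_structure M r) (B : pt M -> set (components M r)).
Implicit Types (O : set (pt M)) (s t : pt M -> components M r).

Definition foliated_span O s : Prop :=
  exists (N : nat) (f : 'I_N -> pt M -> R^o)
    (a : 'I_N -> pt M -> components M r),
    [/\ forall k, smooth_fun O (f k), forall k, B_foliated A L B O (a k) &
        forall q, O q -> s q = \sum_k f k q *: a k q].

Lemma foliated_span_eq O s t : (forall q, O q -> s q = t q) ->
  foliated_span O s -> foliated_span O t.
Proof.
move=> st [N [f [a [Cf aF sE]]]]; exists N, f, a; split=> // q Oq.
by rewrite -st// sE.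
Qed.

Lemma foliated_span_foliated O a : B_foliated A L B O a -> foliated_span O a.
Proof.
move=> aF; exists 1%N, (fun _ _ => 1), (fun=> a); split=> // [k|q Oq].
  exact: smooth_fun_cst.
by rewrite big_ord1 scale1r.
Qed.

Lemma foliated_spanD O s t : foliated_span O s -> foliated_span O t ->
  foliated_span O (fun q => s q + t q).
Proof.
move=> [N [f [a [Cf aF sE]]]] [N' [f' [a' [Cf' aF' tE]]]].
pose g k := match fintype.split k with inl l => f l | inr l => f' l end.
pose c k := match fintype.split k with inl l => a l | inr l => a' l end.
exists (N + N')%N, g, c; split=> [k|k|q Oq].
- by rewrite /g; case: fintype.split.
- by rewrite /c; case: fintype.split.
rewrite sE// tE// big_split_ord/=; congr (_ + _); apply: eq_bigr => k _.
  by rewrite /g /c split_lshift.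
by rewrite /g /c split_rshift.
Qed.

Lemma foliated_spanZ O s (h : pt M -> R^o) : open_in O -> smooth_fun O h ->
  foliated_span O s -> foliated_span O (fun q => h q *: s q).
Proof.
move=> oO Ch [N [f [a [Cf aF sE]]]].
exists N, (fun k q => h q * f k q : R^o), a; split=> // [k i|q Oq].
  exact: (smoothM (open_coords oO) (Ch i) (Cf k i)).
by rewrite sE// scaler_sumr; apply: eq_bigr => k _; rewrite scalerA.
Qed.

Lemma foliated_span_sum O N (s : 'I_N -> pt M -> components M r) :
  (forall k, foliated_span O (s k)) -> foliated_span O (fun q => \sum_k s k q).
Proof.
move=> H; elim: (index_enum _) => [|k l IH].
  exists 0%N, (fun _ _ => 0), (fun _ _ => 0); split; [by case|by case|].
  by move=> q _; rewrite big_nil big_ord0.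
apply: (@foliated_span_eq _ (fun q => s k q + \sum_(k <- l) s k q)).
  by move=> q _; rewrite big_cons.
exact: foliated_spanD.
Qed.

End FoliatedSpan.

(** * Lifts of combinations of sections *)

Section LiftCombinations.
Context {R : realType} (n r : nat) (M : atlas R n) (A : bundle M r).
Hypothesis mM : is_manifold M.
Hypothesis vA : is_vector_bundle A.
Implicit Types (i j : chart M) (p q : pt M) (O : set (pt M))
  (s t : pt M -> components M r) (g : pt M -> R^o).
Local Notation TM := (tangent_manifold M).
Local Notation TA := (tangent_lift_bundle A).
Let vT : is_vector_bundle (tangent_bundle M) := tangent_vector_bundle mM.
Let mT : is_manifold TM := tangent_manifold_is_manifold mM.

Definition differential i g (pv : pt TM) : R^o := deriv i pv.1 pv.2 g.

Lemma smooth_pullback O g : open_in O -> smooth_fun O g ->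
  smooth_fun (M := TM) (tangent_over O) (fun pv : pt TM => g pv.1).
Proof.
move=> oO Cg; rewrite /smooth_fun [chart _]/(chart M) => j.
exact: (smooth_base mM vT oO (Cg j)).
Qed.

Lemma smooth_differential O i g : open_in O -> O `<=` dom i -> smooth_fun O g ->
  smooth_fun (M := TM) (tangent_over O) (differential i g).
Proof.
move=> oO Oi Cg.
have oT := open_in_tangent_over mM oO.
apply: (smooth_from_chart mT (i := i) oT).
  by move=> pv [/Oi iq vq].
have oC : open (coords (M := TM) i (tangent_over O)) := open_coords oT.
have zO (z : 'rV[R]_(n + n)) : coords (M := TM) i (tangent_over O) z ->
  coords i O (lsubmx z).
  exact: tangent_coords_base.
apply: (smooth_eq oC (f := fun z : 'rV[R]_(n + n) =>
  'D_(rsubmx z) (g \o param i) (lsubmx z))).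
  move=> z /zO zi; rewrite [RHS]/(deriv i (param (a := TM) i z).1
    (param (a := TM) i z).2 g) /deriv.
  rewrite tangent_param_vector; [|exact: mM|exact: coords_dom zi].
  have E : (param (a := TM) i z).1 = param i (lsubmx z) by [].
  by have /(coordsP mM)[_ _ zE] := zi; rewrite E zE.
apply: (smooth_derive_along oC (open_coords oO) zO (Cg i)).
  exact: smooth_lsubmx_id.
exact: smooth_rsubmx_id.
Qed.

Lemma vertical_lift_sum O N (g : 'I_N -> pt M -> R^o)
  (a : 'I_N -> pt M -> components M r) s
    (pv : pt TM) : (forall q, O q -> s q = \sum_k g k q *: a k q) ->
      tangent_over O pv ->
  vertical_lift s pv = \sum_k g k pv.1 *: vertical_lift (a k) pv.
Proof.
move=> sE [Op vp]; apply/funext => i; rewrite fct_sumE.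
rewrite /vertical_lift; case: ifP => ip; last first.
  by rewrite big1// => k _; rewrite fctE ip scaler0.
rewrite sE// fct_sumE;
  under [RHS]eq_bigr do rewrite fctE ip scale_row_mx scaler0.
by rewrite sum_row_mx [X in _ = row_mx X _]big1.
Qed.

(** The product rule [(g a)^C = g a^C + dg a^V]. *)
Lemma complete_lift_sum O i N (g : 'I_N -> pt M -> R^o)
  (a : 'I_N -> pt M -> components M r) s
    (pv : pt TM) : open_in O -> section A O s ->
      (forall k, section A O (a k)) ->
  (forall k, smooth_fun O (g k)) ->
  (forall q, O q -> s q = \sum_k g k q *: a k q) ->
  dom i pv.1 -> tangent_over O pv ->
  complete_lift s pv = \sum_k (g k pv.1 *: complete_lift (a k) pv +
    differential i (g k) pv *: vertical_lift (a k) pv).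
Proof.
move=> oO sS aS Cg sE ip pvO; have [Op vp] := pvO.
apply: (fibre_eq (A := TA) (i := i) (p := pv)).
- by [].
- exact: complete_lift_fibre sS pvO.
- apply: fibre_sum => k; apply: fibreD; apply: fibreZ.
    exact: complete_lift_fibre (aS k) pvO.
  exact: vertical_lift_fibre (aS k) pvO.
rewrite complete_liftE// fct_sumE.
under [RHS]eq_bigr do rewrite !fctE complete_liftE// vertical_liftE//
  !scale_row_mx scaler0 add_row_mx addr0.
rewrite sum_row_mx; congr row_mx.
  by rewrite sE// fct_sumE; apply: eq_bigr => k _; rewrite fctE.
pose F k (x : 'rV[R]_n) : 'rV[R]_r := (g k \o param i) x *: local_rep (a k) i x.
have dg k : differentiable (g k \o param i) (coord i pv.1).
  by apply: smooth_differentiable (Cg k i) _; exact: coords_coord.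
have da k : differentiable (local_rep (a k) i) (coord i pv.1).
  exact: local_rep_differentiable (aS k) Op ip.
transitivity ('D_(pv.2 i) (\sum_k F k) (coord i pv.1)).
  apply: near_eq_derive; near=> x.
  have : coords i O x by near: x; exact: near_coords.
  move=> /(coordsP mM)[Ox ix _]; rewrite /local_rep sE// !fct_sumE.
  by apply: eq_bigr => k _; rewrite fctE.
rewrite derive_sum; last first.
  by move=> k; apply: diff_derivable;
    exact: (differentiable_scale (dg k) (da k)).
apply: eq_bigr => k _; rewrite [LHS](derive_scale _ (dg k) (da k)).
by rewrite [(_ \o _) _]/= /local_rep coordK.
Unshelve. all: by end_near. Qed.

(** A case of [lift_combE]: the matrix of components of the constant frame is
    the identity. *)
Lemma section_lift_comb O i (S : pt TM -> components TM (r + r)) (pv : pt TM) :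
  open_in O -> O `<=` dom i -> tangent_over O pv -> fibre TA pv (S pv) ->
  S pv = lift_comb (fun a : 'I_r => constant_frame A i (delta_mx 0 a))
    (fun a => S pv i 0 (lshift r a)) (fun a => S pv i 0 (rshift r a)) pv.
Proof.
move=> oO Oi pvO SA; have [Op vp] := pvO; have ip := Oi _ Op.
have bS (a : 'I_r) : section A O (constant_frame A i (delta_mx 0 a)).
  by apply: section_sub Oi _; exact: constant_frame_section.
apply: (fibre_eq (A := TA) (i := i) (p := pv)) => //;
  first exact: lift_comb_fibre bS pvO.
rewrite (lift_combE _ _ bS)//.
have E1 q : dom i q ->
  frame_mx (fun a : 'I_r => constant_frame A i (delta_mx 0 a)) i q = 1%:M.
  move=> iq; apply/matrixP => a c;
    rewrite !mxE /constant_frame vector_inE// mxE eqxx.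
  by rewrite eq_sym.
have -> : 'D_(pv.2 i)
  (frame_mx (fun a : 'I_r => constant_frame A i (delta_mx 0 a)) i \o param i)
    (coord i pv.1) = 0.
  rewrite -[RHS](derive_cst (1%:M : 'M[R]_r) (coord i pv.1) (pv.2 i)).
  apply: near_eq_derive; near=> x.
  have : coords i O x by near: x; exact: near_coords.
  by move=> /(coordsP mM)[_ ix _]; rewrite [(_ \o _) _]/= E1.
rewrite E1// !mulmx1 mulmx0 add0r -[LHS]hsubmxK.
by congr row_mx; apply/rowP => a; rewrite !mxE.
Unshelve. all: by end_near. Qed.

End LiftCombinations.

(** * TA is locally spanned by TB-foliated sections *)

Section TangentFoliation.
Context {R : realType} (n r : nat) (M : atlas R n) (tr : {set 'I_n})
  (A : bundle M r)
  (L : algebroid_structure M r) (B : pt M -> set (components M r))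
  (TL : algebroid_structure (tangent_manifold M) (r + r)).
Hypothesis fM : is_foliated_manifold M tr.
Hypothesis vA : is_vector_bundle A.
Hypothesis lL : is_lie_algebroid A L.
Local Notation TM := (tangent_manifold M).
Local Notation TA := (tangent_lift_bundle A).
Local Notation TB := (tangent_subbundle A B).
Hypothesis lTL : is_lie_algebroid TA TL.
Hypothesis tTL : is_tangent_structure A L TL.
Hypothesis fB : is_foliation_of tr A L B.
Implicit Types (i j : chart M) (p q : pt M) (O : set (pt M)) (Q : set (pt TM))
  (s t : pt M -> components M r).
Let mM : is_manifold M := foliated_is_manifold fM.
Let mT : is_manifold TM := tangent_manifold_is_manifold mM.

Lemma B_foliatedS O O' a :
  O' `<=` O -> B_foliated A L B O a -> B_foliated A L B O' a.
Proof.
move=> OO' [aS aB]; split; first exact: section_sub aS.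
by move=> Q b oQ QO'; apply: aB => // q /QO'/OO'.
Qed.

(** The spanning hypothesis is about the sections over some fixed open set, to
    which the constant frame need not extend. A multiple of it by a bump
    function [f] does, and one divides by [f] where it is nonzero. *)
Lemma local_foliated_frame p i : dom i p ->
  exists O, [/\ open_in O, O p, O `<=` dom i &
    forall v : 'rV[R]_r, foliated_span A L B O (constant_frame A i v)].
Proof.
move=> ip; have [P [oP Pp span]] := foliation_spanned fB (carrier_dom ip).
have [f [Cf f0 fS]] := bump_section A mM ip.
pose W := [set x | setT x /\ [set y : R^o | y != 0] (f x)].
have oW : open W by exact: open_preimage openT (@open_neq R^o 0) Cf.
pose O := [set q | [/\ P q, dom i q & W (coord i q)]].
have oO : open_in O by exact: open_in_chart.
have OP : O `<=` P by move=> q [].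
have Oi : O `<=` dom i by move=> q [].
exists O; split=> // v.
have [N [g [a [Cg aF E]]]] :=
  span _ (fS _ _ oP (constant_frame_section mM vA i v)).
pose finv q : R^o := (f (coord i q))^-1.
have Cinv : smooth_fun O finv.
  apply: (smooth_from_chart mM oO Oi).
  have oC := open_coords (i := i) oO.
  apply: (smooth_eq oC (f := fun x => (f x)^-1 : R^o)).
    by move=> x /(coordsP mM)[_ _ xE]; rewrite /= /finv xE.
  apply: (smoothV oC); last exact: smooth_sub Cf.
  by move=> x /(coordsP mM)[[_ _ [_ +]] _ xE]; rewrite xE.
apply: (@foliated_span_eq _ _ _ _ _ _ _ _
  (fun q => finv q *: (\sum_k g k q *: a k q))).
  move=> q Oq; have [Pq iq [_ fq]] := Oq.
  by rewrite -E// asboolT// scalerA mulVf// scale1r.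
apply: foliated_spanZ => //; exists N, g, a; split=> // k.
  exact: smooth_funS (Cg k).
exact: B_foliatedS (aF k).
Qed.

(** Lifts of foliated sections are foliated by [foliated_lift], and the lifts of
    a combination are combinations of lifts by [vertical_lift_sum] and
    [complete_lift_sum]. *)
Lemma foliated_span_lifts O i s : open_in O -> O `<=` dom i -> section A O s ->
  foliated_span A L B O s ->
  foliated_span TA TL TB (tangent_over O) (complete_lift s) /\
  foliated_span TA TL TB (tangent_over O) (vertical_lift s).
Proof.
move=> oO Oi sS [N [g [a [Cg aF sE]]]].
have oT := open_in_tangent_over mM oO.
have sB := foliation_subalgebroid fB.
have CF k : foliated_span TA TL TB (tangent_over O) (complete_lift (a k)).
  by apply: foliated_span_foliated;
    apply: (foliated_lift mM vA lL lTL tTL sB oO (aF k)); left.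
have VF k : foliated_span TA TL TB (tangent_over O) (vertical_lift (a k)).
  by apply: foliated_span_foliated;
    apply: (foliated_lift mM vA lL lTL tTL sB oO (aF k)); right.
have VS (h : 'I_N -> pt TM -> R^o) :
  (forall k, smooth_fun (M := TM) (tangent_over O) (h k)) ->
    forall k, foliated_span TA TL TB (tangent_over O)
      (fun pv => h k pv *: vertical_lift (a k) pv).
  by move=> Ch k; exact: (foliated_spanZ oT (Ch k) (VF k)).
have Cp k := smooth_pullback mM oO (Cg k).
have Cd k := smooth_differential mM oO Oi (Cg k).
split.
  suff H : foliated_span TA TL TB (tangent_over O) (fun pv : pt TM =>
      \sum_k (g k pv.1 *: complete_lift (a k) pv +
              differential i (g k) pv *: vertical_lift (a k) pv)).
    apply: foliated_span_eq H => pv pvO; have [Op _] := pvO.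
    apply/esym.
    by apply: (complete_lift_sum mM vA oO sS _ Cg sE (Oi _ Op) pvO) => k;
      case: (aF k).
  apply: foliated_span_sum => k; apply: foliated_spanD;
    last exact: (VS (fun k => differential i (g k)) Cd).
  exact: (foliated_spanZ oT (Cp k) (CF k)).
suff H : foliated_span TA TL TB (tangent_over O) (fun pv : pt TM =>
    \sum_k g k pv.1 *: vertical_lift (a k) pv).
  by apply: foliated_span_eq H => pv pvO; apply/esym;
    exact: (vertical_lift_sum sE pvO).
by apply: foliated_span_sum; exact: (VS (fun k pv => g k pv.1) Cp).
Qed.

Lemma tangent_foliation_spanned (pv : pt TM) : carrier TM pv ->
  exists Q, [/\ open_in Q, Q pv & forall S, section TA Q S ->
    foliated_span TA TL TB Q S].
Proof.
move=> [i0 _ [/= ip0 vp]].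
have [i ip] : exists i : chart M, dom i pv.1 by exists i0.
have [P [oP Pp Pi span]] := local_foliated_frame ip.
have oT := open_in_tangent_over mM oP.
exists (tangent_over P); split=> // S SS.
have bS (a : 'I_r) : section A P (constant_frame A i (delta_mx 0 a)).
  by apply: section_sub Pi _; exact: constant_frame_section.
have LF (a : 'I_r) := foliated_span_lifts oP Pi (bS a) (span (delta_mx 0 a)).
have Cc (k : 'I_(r + r)) : smooth_fun (M := TM) (tangent_over P)
  (fun pv : pt TM => S pv i 0 k).
  apply: (smooth_from_chart mT (i := i) oT); first by move=> q [/Pi].
  have [_ /(_ i) CS] := SS.
  exact: (smooth_entry 0 k (open_coords oT) CS).
pose s1 (a : 'I_r) (q : pt TM) :=
  S q i 0 (lshift r a) *: complete_lift (constant_frame A i (delta_mx 0 a)) q.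
pose s2 (a : 'I_r) (q : pt TM) :=
  S q i 0 (rshift r a) *: vertical_lift (constant_frame A i (delta_mx 0 a)) q.
suff H : foliated_span TA TL TB (tangent_over P)
  (fun q : pt TM => (\sum_a s1 a q) + (\sum_a s2 a q)).
  apply: foliated_span_eq H => q qP; apply/esym;
    apply: (section_lift_comb mM vA oP Pi qP).
  by have [+ _] := SS; apply.
apply: foliated_spanD; apply: foliated_span_sum => a.
  by apply: (foliated_spanZ oT (Cc (lshift r a))); case: (LF a).
by apply: (foliated_spanZ oT (Cc (rshift r a))); case: (LF a).
Qed.

End TangentFoliation.

Theorem proposition2p1 (R : realType) (n r : nat) (M : atlas R n)
    (tr : {set 'I_n}) (A : bundle M r) (L : algebroid_structure M r)
    (B : pt M -> set (components M r))
    (TL : algebroid_structure (tangent_manifold M) (r + r)) :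
  is_foliated_manifold M tr ->
  is_vector_bundle A ->
  is_lie_algebroid A L ->
  is_foliation_of tr A L B ->
  is_lie_algebroid (tangent_lift_bundle A) TL ->
  is_tangent_structure A L TL ->
  [/\ is_foliated_manifold (tangent_manifold M) (tangent_foliation tr),
      is_vector_bundle (tangent_lift_bundle A) &
      is_foliation_of (tangent_foliation tr) (tangent_lift_bundle A) TL
        (tangent_subbundle A B)].
Proof.
move=> fM vA lL fB lTL tTL; have mM := foliated_is_manifold fM.
split; [exact: tangent_foliated_manifold|exact: tangent_lift_vector_bundle|].
split.
- exact: (tangent_lie_subalgebroid mM vA lL lTL tTL
  (foliation_subalgebroid fB)).
- exact: (tangent_anchor_image fM vA lL lTL tTL fB).
- exact: (tangent_foliation_spanned fM vA lL lTL tTL fB).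
Qed.
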